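(* Let $\mathbf G$ be connected reductive and let $A\in\mathfrak g_F$ be a connection. There exists a positive integer $n$ such that all connections $C\in\mathfrak g_F$ satisfying $C\equiv A\pmod{t^n}$ are $\mathbf G(\overline F)$-gauge equivalent to $A$.
   Context: $\mathbf k$ is an algebraically closed field of characteristic $0$, $\mathbf G$ is an algebraic group over $\mathbf k$; $\mathcal O=\mathbf k[[t]]$, $F=\mathbf k((t))$, $\overline F=\bigcup_{b\ge1}\mathbf k((t^{1/b}))$ is the algebraic closure of $F$; $\mathfrak g=\mathrm{Lie}(\mathbf G)$, $\mathfrak g_K=\mathfrak g\otimes_{\mathbf k}K$. A connection is an element of $\mathfrak g_F$. The gauge action of $\mathbf G(\overline F)$ on $\mathfrak g_{\overline F}$ is $x\cdot A=\mathrm{Ad}(x)A+\frac{dx}{dt}x^{-1}$ (computed in any faithful representation), and two connections are $\mathbf G(\overline F)$-gauge equivalent if they lie in the same orbit. $C\equiv A\pmod{t^n}$ means $C-A\in t^n\,\mathfrak g\otimes_{\mathbf k}\mathcal O$. *)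

(* Defs.v *)
From HB Require Import structures.
From mathcomp Require Import all_boot all_order all_algebra.
From mathcomp Require Import boolp classical_sets functions cardinality fsbigop.
From mathcomp Require Import mpoly.

Set Implicit Arguments.
Unset Strict Implicit.
Unset Printing Implicit Defensive.

Import Order.TTheory GRing.Theory Num.Theory.
Local Open Scope classical_set_scope.
Local Open Scope ring_scope.

(** * Puiseux series

   A series \sum_q f_q t^q is encoded by its coefficient function f : rat -> k.
   It lies in t^(v/b) k[[t^(1/b)]] when its support consists of exponents
   (v + m)/b with m : nat. *)

Definition expo (b : nat) (v : int) (m : nat) : rat := (v%:~R + m%:R) / b%:R.

Definition supp_in (k : fieldType) (b : nat) (v : int) (f : rat -> k) : Prop :=
  forall q, f q != 0 -> exists m : nat, q = expo b v m.

Definition is_puiseux (k : fieldType) (f : rat -> k) : Prop :=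
  exists (b : nat) (v : int), (0 < b)%N /\ supp_in b v f.

Record puiseux (k : fieldType) := Puiseux {
  pcoef :> rat -> k;
  pcoefP : is_puiseux pcoef }.

HB.instance Definition _ (k : fieldType) := gen_eqMixin (puiseux k).
HB.instance Definition _ (k : fieldType) := gen_choiceMixin (puiseux k).

Section PuiseuxField.
Variable k : fieldType.
Implicit Types (f g h : rat -> k) (b m n : nat) (v w : int) (q r : rat).

Lemma puiseux_eqP (f g : puiseux k) : f =1 g -> f = g.
Proof.
case: f g => [f fP] [g gP] /= /funext E; subst g.
by congr Puiseux; exact: Prop_irrelevance.
Qed.

Lemma expoD b v w m n : expo b v m + expo b w n = expo b (v + w) (m + n).
Proof. by rewrite /expo -mulrDl rmorphD natrD addrACA. Qed.

Lemma expo_inj b v : (0 < b)%N -> injective (expo b v).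
Proof.
move=> b0 m n /(congr1 (fun x => x * b%:R)); rewrite /expo.
have bU : b%:R != 0 :> rat by rewrite pnatr_eq0 -lt0n.
by rewrite !divfK // => /addrI /eqP; rewrite eqr_nat => /eqP.
Qed.

Lemma supp_in_mulb b v c f : (0 < b)%N -> (0 < c)%N ->
  supp_in b v f -> supp_in (b * c) (v * c%:Z) f.
Proof.
move=> b0 c0 sf q /sf [m ->]; exists (m * c)%N; rewrite /expo.
have cU : c%:R != 0 :> rat by rewrite pnatr_eq0 -lt0n.
rewrite rmorphM !natrM /= -[in c%:Z%:~R]pmulrn -mulrDl -mulf_div divff // mulr1.
by [].
Qed.

Lemma supp_in_le b v w f : w <= v -> supp_in b v f -> supp_in b w f.
Proof.
move=> wv sf q /sf [m ->].
have [d vE] : exists d : nat, v = w + d%:Z.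
  by exists `|(v - w)%R|%N; rewrite gez0_abs ?subr_ge0 // addrC subrK.
by exists (d + m)%N; rewrite /expo vE rmorphD natrD /= addrA.
Qed.

Lemma puiseux_common f g : is_puiseux f -> is_puiseux g ->
  exists b v, [/\ (0 < b)%N, supp_in b v f & supp_in b v g].
Proof.
move=> [b [v [b0 sf]]] [c [w [c0 sg]]].
exists (b * c)%N, (Num.min (v * c%:Z) (w * b%:Z)); split.
- by rewrite muln_gt0 b0.
- by apply: (supp_in_le _ (supp_in_mulb b0 c0 sf)); rewrite ge_min lexx.
- rewrite mulnC.
  by apply: (supp_in_le _ (supp_in_mulb c0 b0 sg)); rewrite ge_min lexx orbT.
Qed.

Lemma supp_in_add b v f g :
  supp_in b v f -> supp_in b v g -> supp_in b v (fun q => f q + g q).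
Proof.
move=> sf sg q; have [/eqP ->|/sf //] := boolP (f q == 0).
by rewrite add0r => /sg.
Qed.

Fact add_subproof (f g : puiseux k) : is_puiseux (fun q => f q + g q).
Proof.
have [b [v [b0 sf sg]]] := puiseux_common (pcoefP f) (pcoefP g).
by exists b, v; split=> //; exact: supp_in_add.
Qed.

Fact opp_subproof (f : puiseux k) : is_puiseux (fun q => - f q).
Proof.
have [b [v [b0 sf]]] := pcoefP f.
by exists b, v; split=> // q; rewrite oppr_eq0 => /sf.
Qed.

Fact const_subproof (c : k) : is_puiseux (fun q => if q == 0 then c else 0).
Proof.
exists 1%N, 0; split=> // q; have [->|_] := eqVneq q 0; last by rewrite eqxx.
by exists 0%N; rewrite /expo addr0 mul0r.
Qed.


Definition padd (f g : puiseux k) := Puiseux (add_subproof f g).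
Definition popp (f : puiseux k) := Puiseux (opp_subproof f).
Definition puiseuxC (c : k) := Puiseux (const_subproof c).

Fact paddA : associative padd.
Proof. by move=> f g h; apply: puiseux_eqP => q /=; rewrite addrA. Qed.
Fact paddC : commutative padd.
Proof. by move=> f g; apply: puiseux_eqP => q /=; rewrite addrC. Qed.
Fact padd0 : left_id (puiseuxC 0) padd.
Proof. by move=> f; apply: puiseux_eqP => q /=; rewrite if_same add0r. Qed.
Fact paddN : left_inverse (puiseuxC 0) popp padd.
Proof. by move=> f; apply: puiseux_eqP => q /=; rewrite if_same addNr. Qed.

HB.instance Definition _ :=
  GRing.isZmodule.Build (puiseux k) paddA paddC padd0 paddN.

(* Only finitely many terms are nonzero when f and g are Puiseux series. *)
Definition conv f g q : k := \sum_(r \in [set: rat]) (f r * g (q - r)).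

Lemma conv_supp b v w f g :
  supp_in b v f -> supp_in b w g -> supp_in b (v + w) (conv f g).
Proof.
move=> sf sg q; have [[r /eqP]|N] := pselect (exists r, f r * g (q - r) <> 0).
  rewrite mulf_eq0 negb_or => /andP[/sf [m rE] /sg [n qrE]] _.
  by exists (m + n)%N; rewrite -expoD -rE -qrE addrC subrK.
rewrite /conv fsbig1 ?eqxx // => r _.
by apply: contrapT => Nr; apply: N; exists r.
Qed.

Lemma conv_expo b v w f g m : (0 < b)%N -> supp_in b v f -> supp_in b w g ->
  conv f g (expo b (v + w) m) =
  \sum_(i < m.+1) f (expo b v i) * g (expo b w (m - i)).
Proof.
move=> b0 sf sg.
pose s := [seq expo b v i | i <- iota 0 m.+1].
have us : uniq s by rewrite map_inj_uniq ?iota_uniq //; exact: expo_inj.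
rewrite /conv (fsbigE s) //; last first.
  move=> r _ rs; apply: contrapT => /eqP; rewrite mulf_eq0 negb_or.
  move=> /andP[/sf [i rE] /sg [j]] /(canRL (subrK _)).
  rewrite rE expoD addrC => /(expo_inj b0) mE; move: rs.
  by rewrite rE map_f // mem_iota /= add0n ltnS mE leq_addl.
under eq_bigl do rewrite in_setT.
rewrite big_map -[iota 0 _]/(index_iota 0 m.+1) big_mkord.
apply: eq_bigr => i _; congr (_ * g _).
by apply/eqP; rewrite subr_eq expoD addrC subnK // -ltnS.
Qed.

Fact mul_subproof (f g : puiseux k) : is_puiseux (conv f g).
Proof.
have [b [v [b0 sf sg]]] := puiseux_common (pcoefP f) (pcoefP g).
by exists b, (v + v); split=> //; exact: conv_supp.
Qed.

Definition pmul (f g : puiseux k) := Puiseux (mul_subproof f g).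

Lemma eq_supp b v f g : supp_in b v f -> supp_in b v g ->
  (forall m, f (expo b v m) = g (expo b v m)) -> f =1 g.
Proof.
move=> sf sg E q; have [/eqP fq|/sf [m ->] //] := boolP (f q == 0).
by have [/eqP ->|/sg [m qE]] := boolP (g q == 0); rewrite // qE.
Qed.

Lemma conv_poly b v w f g m n : (0 < b)%N -> (m < n)%N ->
  supp_in b v f -> supp_in b w g ->
  conv f g (expo b (v + w) m) =
  (\poly_(i < n) f (expo b v i) * \poly_(i < n) g (expo b w i))`_m.
Proof.
move=> b0 mn sf sg; rewrite conv_expo // coefM; apply: eq_bigr => i _.
rewrite !coef_poly (leq_trans (ltn_ord i) mn).
by rewrite (leq_ltn_trans (leq_subr _ _) mn).
Qed.

Fact pmulC : commutative pmul.
Proof.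
move=> f g; apply: puiseux_eqP.
have [b [v [b0 sf sg]]] := puiseux_common (pcoefP f) (pcoefP g).
apply: (@eq_supp b (v + v)); [exact: conv_supp|exact: conv_supp|move=> m /=].
by rewrite !(@conv_poly _ _ _ _ _ _ m.+1) // mulrC.
Qed.

Lemma puiseux_common3 f g h : is_puiseux f -> is_puiseux g -> is_puiseux h ->
  exists b v, [/\ (0 < b)%N, supp_in b v f, supp_in b v g & supp_in b v h].
Proof.
move=> Pf Pg [c [w [c0 sh]]]; have [b [v [b0 sf sg]]] := puiseux_common Pf Pg.
exists (b * c)%N, (Num.min (v * c%:Z) (w * b%:Z)); split.
- by rewrite muln_gt0 b0.
- by apply: (supp_in_le _ (supp_in_mulb b0 c0 sf)); rewrite ge_min lexx.
- by apply: (supp_in_le _ (supp_in_mulb b0 c0 sg)); rewrite ge_min lexx.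
- rewrite mulnC.
  by apply: (supp_in_le _ (supp_in_mulb c0 b0 sh)); rewrite ge_min lexx orbT.
Qed.

Fact pmulA : associative pmul.
Proof.
move=> f g h; apply: puiseux_eqP.
have [b [v [b0 sf sg sh]]] :=
  puiseux_common3 (pcoefP f) (pcoefP g) (pcoefP h).
apply: (@eq_supp b (v + v + v)) => [||m /=].
- by rewrite -addrA; do 2 apply: conv_supp => //.
- by do 2 apply: conv_supp => //.
rewrite -[in LHS]addrA.
rewrite !(@conv_poly _ _ _ _ _ _ m.+1) //; try exact: conv_supp.
set F := \poly_(i < m.+1) f (expo b v i).
set G := \poly_(i < m.+1) g (expo b v i).
set H := \poly_(i < m.+1) h (expo b v i).
have trunc (p q r : {poly k}) : (forall i, (i < m.+1)%N -> p`_i = q`_i) ->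
    (p * r)`_m = (q * r)`_m.
  by move=> E; rewrite !coefM; apply: eq_bigr => i _; rewrite E.
rewrite [F * _]mulrC (trunc _ (G * H) F); last first.
  by move=> i im; rewrite coef_poly im (@conv_poly _ _ _ _ _ _ m.+1).
rewrite (trunc _ (F * G) H); last first.
  by move=> i im; rewrite coef_poly im (@conv_poly _ _ _ _ _ _ m.+1).
by rewrite mulrC mulrA.
Qed.

Fact pmul1 : left_id (puiseuxC 1) pmul.
Proof.
move=> f; apply: puiseux_eqP => q /=; rewrite /conv (fsbigE [:: 0]) //=.
  by rewrite big_cons big_nil in_setT eqxx mul1r subr0 addr0.
by move=> r _; rewrite inE => /negPf ->; rewrite mul0r.
Qed.

Fact pmulDl : left_distributive pmul padd.
Proof.
move=> f g h; apply: puiseux_eqP.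
have [b [v [b0 sf sg sh]]] :=
  puiseux_common3 (pcoefP f) (pcoefP g) (pcoefP h).
have sfg := supp_in_add sf sg.
apply: (@eq_supp b (v + v)) => [||m /=].
- exact: conv_supp.
- by apply: supp_in_add; exact: conv_supp.
rewrite !conv_expo // -big_split; apply: eq_bigr => i _ /=.
by rewrite mulrDl.
Qed.

Fact pone_neq0 : puiseuxC 1 != 0.
Proof.
apply/eqP => /(congr1 (fun f : puiseux k => f 0)) /=.
by move/eqP; rewrite ?eqxx oner_eq0.
Qed.

HB.instance Definition _ := GRing.Zmodule_isComNzRing.Build (puiseux k)
  pmulA pmulC pmul1 pmulDl pone_neq0.

(* Power series inversion: the first n coefficients of 1 / \sum_i u_i s^i. *)
Fixpoint inv_seq (u : nat -> k) (n : nat) : seq k :=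
  if n is n'.+1 then
    let s := inv_seq u n' in
    rcons s (- (u 0%N)^-1 * \sum_(i < n') u (n' - i)%N * s`_i
             + (n' == 0%N)%:R * (u 0%N)^-1)
  else [::].

Lemma size_inv_seq (u : nat -> k) n : size (inv_seq u n) = n.
Proof. by elim: n => //= n IH; rewrite size_rcons IH. Qed.

Lemma inv_seqE (u : nat -> k) n m :
  (m < n)%N -> (inv_seq u n)`_m = (inv_seq u m.+1)`_m.
Proof.
elim: n => // n IH; rewrite ltnS leq_eqVlt => /orP[/eqP -> //|mn].
by rewrite -IH //= nth_rcons size_inv_seq mn.
Qed.

Lemma inv_seqP (u : nat -> k) : u 0%N != 0 -> exists p : nat -> k,
  forall m, \sum_(i < m.+1) u (m - i)%N * p i = (m == 0%N)%:R.
Proof.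
move=> u0; exists (fun m => (inv_seq u m.+1)`_m) => m.
rewrite big_ord_recr /= subnn nth_rcons size_inv_seq ltnn eqxx.
under eq_bigr => i _ do rewrite -[rcons _ _]/(inv_seq u i.+1) -(inv_seqE u (ltn_ord i)).
rewrite mulrDr mulrA mulrN divff // mulN1r addrA subrr add0r.
by rewrite mulrCA divff // mulr1.
Qed.

Fact puiseux_mulVf (f : puiseux k) : f != 0 -> exists g : puiseux k, g * f = 1.
Proof.
move=> f0; have [b [v [b0 sf]]] := pcoefP f.
have exm : exists m, f (expo b v m) != 0.
  apply: contrapT => N; case/eqP: f0; apply: puiseux_eqP => q /=; rewrite if_same.
  apply/eqP; apply: contrapT => /negP fq; apply: N.
  by have [m qE] := sf _ fq; exists m; rewrite -qE.
have [m fm mmin] := ex_minnP exm.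
have {}sf : supp_in b (v + m%:Z) f.
  move=> q fq; have [n qE] := sf _ fq; exists (n - m)%N.
  have mn : (m <= n)%N by apply: mmin; rewrite -qE.
  by rewrite qE -{1}(subnKC mn) /expo natrD rmorphD /= addrA.
have {}fm : f (expo b (v + m%:Z) 0) != 0.
  by rewrite /expo rmorphD /= addr0; move: fm; rewrite /expo.
move: (v + m%:Z) sf fm => {exm mmin m}{}v sf fv.
have [p pP] := @inv_seqP (fun n => f (expo b v n)) fv.
pose g q : k := if pselect (exists m, q = expo b (- v) m) is left H
                then p (projT1 (cid H)) else 0.
have sg : supp_in b (- v) g.
  by rewrite /g => q; case: pselect => //; rewrite eqxx.
have gE m : g (expo b (- v) m) = p m.
  rewrite /g; case: pselect => [H|[]]; last by exists m.
  by case: cid => n /= /(expo_inj b0) ->.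
have Pg : is_puiseux g by exists b, (- v).
exists (Puiseux Pg); rewrite mulrC; apply: puiseux_eqP.
apply: (@eq_supp b 0).
- by rewrite -(subrr v); exact: conv_supp.
- move=> q /=; have [->|_] := eqVneq q 0; last by rewrite eqxx.
  by exists 0%N; rewrite /expo addr0 mul0r.
move=> n /=; rewrite -(subrr v) conv_expo // subrr.
rewrite (reindex_inj rev_ord_inj) /=.
under eq_bigr => i _ do rewrite subSS subKn -1?ltnS // gE.
rewrite pP /expo add0r mulf_eq0 invr_eq0 !pnatr_eq0 (gtn_eqF b0) orbF.
by case: eqP.
Qed.

Definition pinv (f : puiseux k) : puiseux k :=
  if pselect (exists g : puiseux k, g * f = 1) is left H then projT1 (cid H) else 0.

Fact pmulV (f : puiseux k) : f != 0 -> pinv f * f = 1.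
Proof.
move=> /puiseux_mulVf fV; rewrite /pinv; case: pselect => [H|/(_ fV) //].
by case: cid.
Qed.

Fact pinv0 : pinv 0 = 0.
Proof.
rewrite /pinv; case: pselect => // H; exfalso; case: H => g /eqP.
by rewrite mulr0 eq_sym oner_eq0.
Qed.

HB.instance Definition _ :=
  GRing.ComNzRing_isField.Build (puiseux k) pmulV pinv0.

Fact puiseuxC_is_zmod : zmod_morphism puiseuxC.
Proof.
move=> c d; apply: puiseux_eqP => q /=.
by case: (q == 0); rewrite ?subr0.
Qed.

Fact puiseuxC_is_monoid : monoid_morphism puiseuxC.
Proof.
split=> // c d; apply: puiseux_eqP => q /=; rewrite /conv (fsbigE [:: 0]) //=.
  by rewrite big_cons big_nil in_setT eqxx subr0 addr0; case: ifP; rewrite ?mulr0.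
by move=> r _; rewrite inE => /negPf ->; rewrite mul0r.
Qed.

HB.instance Definition _ :=
  GRing.isZmodMorphism.Build k (puiseux k) puiseuxC puiseuxC_is_zmod.
HB.instance Definition _ :=
  GRing.isMonoidMorphism.Build k (puiseux k) puiseuxC puiseuxC_is_monoid.

Fact deriv_subproof (f : puiseux k) :
  is_puiseux (fun q => ratr (q + 1) * f (q + 1)).
Proof.
have [b [v [b0 sf]]] := pcoefP f; exists b, (v - b%:Z); split=> // q.
rewrite mulf_eq0 negb_or => /andP[_ /sf [m qE]]; exists m.
have bU : b%:R != 0 :> rat by rewrite pnatr_eq0 -lt0n.
rewrite -[LHS](addrK 1) qE /expo rmorphB /= addrAC [RHS]mulrBl.
by congr (_ - _); rewrite divff.
Qed.

(* d/dt (\sum_q f_q t^q) = \sum_q (q + 1) f_(q+1) t^q *)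
Definition pderiv (f : puiseux k) := Puiseux (deriv_subproof f).

End PuiseuxField.

(* F = k((t)), as a subset of the Puiseux series *)
Definition laurent (k : fieldType) : set (puiseux k) :=
  [set f | exists v : int, supp_in 1 v f].

(* t^n O, where O = k[[t]] *)
Definition tpow_integers (k : fieldType) (n : nat) : set (puiseux k) :=
  [set f | supp_in 1 n%:Z f].

(** * Linear algebraic groups

   An affine algebraic group over the algebraically closed field k of
   characteristic 0 is given by its group of k-points inside some GL_N(k), i.e.
   together with a faithful representation.  In characteristic 0 algebraic
   groups are reduced, so that the defining ideal is the ideal of all the
   polynomials in the matrix entries that vanish on the k-points. *)

Definition peval (K : fieldType) (N : nat) (p : {mpoly K[N * N]})
  (x : 'M[K]_N) : K := p.@[fun i => mxvec x 0 i].

(* Every regular function on GL_N is p / det^m for a polynomial p, so that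
   polynomials in the entries are enough to define the closed subsets. *)
Definition zclosed (k : fieldType) (N : nat) (E : set 'M[k]_N) : Prop :=
  exists S : set {mpoly k[N * N]},
    forall x, E x <-> x \in unitmx /\ (forall p, S p -> peval p x = 0).

Record lin_alg_group (k : fieldType) (N : nat) := LinAlgGroup {
  lag_points :> 'M[k]_N -> Prop;
  lag_closed : zclosed lag_points;
  lag1 : lag_points 1%:M;
  lagM : forall x y, lag_points x -> lag_points y -> lag_points (x *m y);
  lagV : forall x, lag_points x -> lag_points (invmx x) }.

Section LinAlgGroups.
Variables (k : fieldType) (N : nat).
Implicit Types G H : lin_alg_group k N.

Definition lag_connected G : Prop :=
  forall Z1 Z2 : set 'M[k]_N, zclosed Z1 -> zclosed Z2 ->
    (forall x, G x -> Z1 x \/ Z2 x) ->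
    (forall x, G x -> ~ (Z1 x /\ Z2 x)) ->
    (forall x, G x -> Z1 x) \/ (forall x, G x -> Z2 x).

Definition lag_normal H G : Prop :=
  (forall h, H h -> G h) /\
  (forall g h, G g -> H h -> H (g *m h *m invmx g)).

Definition unipotent_mx (x : 'M[k]_N) : Prop :=
  exists m : nat, (x - 1%:M) ^+ m = 0.

Definition lag_unipotent H : Prop := forall x, H x -> unipotent_mx x.

(* The unipotent radical is trivial.  Connectedness is not included. *)
Definition lag_reductive G : Prop :=
  forall H, lag_normal H G -> lag_connected H -> lag_unipotent H ->
    forall x, H x -> x = 1%:M.

Definition vanishing_ideal G : set {mpoly k[N * N]} :=
  [set p | forall x, G x -> peval p x = 0].

(* The differential at the identity of a polynomial in the entries. *)
Definition diff1 (p : {mpoly k[N * N]}) (X : 'M[k]_N) : k :=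
  \sum_(i < N * N) peval p^`M(i) 1%:M * mxvec X 0 i.

(* g = Lie(G), the tangent space at the identity *)
Definition lie_algebra G : set 'M[k]_N :=
  [set X | forall p, vanishing_ideal G p -> diff1 p X = 0].

(* For an additive subgroup S of the Puiseux series stable under k, the image
   of g (x)_k S in the matrices over the Puiseux series; g (x)_k S embeds there
   since g is a k-subspace of 'M[k]_N. *)
Definition lie_tensor G (S : set (puiseux k)) : set 'M[puiseux k]_N :=
  [set A | exists (m : nat) (c : 'I_m -> puiseux k) (X : 'I_m -> 'M[k]_N),
    [/\ forall i, S (c i), forall i, lie_algebra G (X i)
      & A = \sum_(i < m) c i *: map_mx (@puiseuxC k) (X i)]].

(* the points of G over \overline F = \bigcup_b k((t^(1/b))) *)
Definition puiseux_points G : set 'M[puiseux k]_N :=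
  [set x | x \in unitmx /\ forall p, vanishing_ideal G p ->
     peval (map_mpoly (@puiseuxC k) p) x = 0].

(* x . A = Ad(x) A + (dx/dt) x^-1 *)
Definition gauge_act (x A : 'M[puiseux k]_N) : 'M[puiseux k]_N :=
  x *m A *m invmx x + map_mx (@pderiv k) x *m invmx x.

Definition gauge_equiv G (A C : 'M[puiseux k]_N) : Prop :=
  exists2 x, puiseux_points G x & gauge_act x A = C.

Definition connection G : set 'M[puiseux k]_N := lie_tensor G (@laurent k).

Definition congr_mod_tpow G (n : nat) (C A : 'M[puiseux k]_N) : Prop :=
  lie_tensor G (@tpow_integers k n) (C - A).

End LinAlgGroups.

(* Main.v *)
(* The gauge equation x C + x' = A x is linear in the matrix x.  Writing
   C = A + E and x = 1 + y, it becomes y' - A y + y A + y E = - E.  A formal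
   connection on a finite-dimensional space over k((t)) is bijective on lattices of
   sufficiently high order, up to a bounded loss of order: expressing it through
   scalar differential operators, this comes down to the fact that an indicial
   polynomial has finitely many roots.  When E has high order, y E is a negligible
   perturbation and there is a solution x congruent to 1 modulo a high power of t.

   It remains to see that x lies in G.  Let g_1, ..., g_r generate the ideal of G.
   As A and C take values in the Lie algebra, whose left and right invariant
   derivations preserve this ideal, the vector v = (g_i(x)) satisfies a linear
   system v' = v M(x).  Since x is close to 1, this is a small perturbation of the
   system v' = v M(1), which depends on A only and has no nonzero solution of high
   order.  As g_i(1) = 0, the vector v has high order; hence v = 0. *)
From HB Require Import structures.
Require Import Defs.
From mathcomp Require Import all_boot all_order all_algebra.
From mathcomp Require Import boolp classical_sets functions cardinality fsbigop.
From mathcomp Require Import mpoly.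
From mathcomp Require Import zify ring.

Set Implicit Arguments.
Unset Strict Implicit.
Unset Printing Implicit Defensive.

Import Order.TTheory GRing.Theory Num.Theory.
Local Open Scope ring_scope.

(** * Orders of Laurent series *)

Section RatrCharZero.
Variable k : fieldType.
Hypothesis char0 : [pchar k] =i pred0.

Lemma intr_eq0_pchar0 (z : int) : (z%:~R == 0 :> k) = (z == 0).
Proof.
have /pcharf0P c0 := char0.
case: z => n; first exact: c0.
by rewrite NegzE mulrNz oppr_eq0 -[_ *~ _]/(n.+1%:R) c0.
Qed.

(** Characteristic 0 keeps the denominators nonzero in [k], so the integral identity [E], once
    mapped to [k], can be divided by them. *)
Lemma ratr_pchar0D (x y : rat) : ratr (x + y) = ratr x + ratr y :> k.
Proof.
have dn0 (z : rat) : (denq z)%:~R != 0 :> k.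
  by rewrite intr_eq0_pchar0 denq_neq0.
have dq (z : rat) : (denq z)%:~R != 0 :> rat by rewrite intr_eq0 denq_neq0.
have E : numq (x + y) * denq x * denq y =
         (numq x * denq y + numq y * denq x) * denq (x + y).
  apply: (@intr_inj rat); rewrite !(rmorphM, rmorphD) /= !numqE; ring.
have /(congr1 (fun z : int => z%:~R : k)) := E.
rewrite !(rmorphM, rmorphD) /= /ratr => {}E.
apply: (mulIf (dn0 (x + y))); apply: (mulIf (dn0 x)); apply: (mulIf (dn0 y)).
rewrite divfK // E [RHS]mulrAC.
by rewrite -[RHS]mulrA mulrACA; field; rewrite ?dn0.
Qed.

(** Differentiation multiplies each coefficient by its exponent. In a convolution that exponent is a
    sum of two, which [ratr] splits additively. *)
Lemma pderivM (f g : puiseux k) :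
  pderiv (f * g) = pderiv f * g + f * pderiv g.
Proof.
apply: puiseux_eqP.
have [b [v [b0 sf sg]]] := puiseux_common (pcoefP f) (pcoefP g).
have bU : b%:R != 0 :> rat by rewrite pnatr_eq0 -lt0n.
have expo_shift w m : expo b (w - b%:Z) m + 1 = expo b w m.
  apply: (mulIf bU); rewrite mulrDl mul1r /expo !divfK // rmorphB /=.
  by rewrite -[b%:Z%:~R]/(b%:R : rat); ring.
have sd (w : int) (h : puiseux k) :
    supp_in b w h -> supp_in b (w - b%:Z) (pderiv h).
  move=> sh q; rewrite /= mulf_eq0 negb_or => /andP[_ /sh [m qE]]; exists m.
  by apply: (addIr 1); rewrite expo_shift.
have eqv : v + v - b%:Z = v - b%:Z + v by rewrite addrAC.
have eqv' : v + v - b%:Z = v + (v - b%:Z) by rewrite addrA.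
apply: (@eq_supp _ b (v + v - b%:Z)).
- by apply: sd; exact: conv_supp.
- apply: supp_in_add; first by rewrite eqv; apply: conv_supp => //; exact: sd.
  by rewrite eqv'; apply: conv_supp => //; exact: sd.
move=> m /=; rewrite expo_shift conv_expo //.
rewrite {1}eqv eqv' !conv_expo //; do ?exact: sd.
rewrite mulr_sumr -big_split /=; apply: eq_bigr => i _.
rewrite !expo_shift -{1}(subnKC (ltn_ord i : i <= m)%N) -expoD ratr_pchar0D.
by ring.
Qed.

End RatrCharZero.

Section Order.
Variable k : fieldType.
Implicit Types (f g : puiseux k) (m n : int).

(** Ramification index 1 is built in, so that a bound on the order also makes the series Laurent. *)
Definition ordge m f := supp_in 1 m f.

Lemma expo1 m (i : nat) : expo 1 m i = (m + i%:Z)%:~R.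
Proof. by rewrite /expo divr1 rmorphD. Qed.

Lemma ordgeP m f :
  ordge m f <-> (forall q, f q != 0 -> exists2 z : int, q = z%:~R & m <= z).
Proof.
split=> H q /H; first by move=> [i ->]; rewrite expo1; exists (m + i%:Z) => //; lia.
move=> [z -> mz]; exists `|z - m|%N; rewrite expo1; congr (_%:~R); lia.
Qed.

Lemma ordgeW m n f : n <= m -> ordge m f -> ordge n f.
Proof. exact: supp_in_le. Qed.

Lemma ordge0 m : ordge m 0.
Proof. by move=> q /=; rewrite if_same eqxx. Qed.

Lemma ordgeD m f g : ordge m f -> ordge m g -> ordge m (f + g).
Proof. exact: supp_in_add. Qed.

Lemma ordgeN m f : ordge m f -> ordge m (- f).
Proof. by move=> H q /=; rewrite oppr_eq0 => /H. Qed.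

Lemma ordgeB m f g : ordge m f -> ordge m g -> ordge m (f - g).
Proof. by move=> Hf Hg; apply: ordgeD => //; exact: ordgeN. Qed.

Lemma ordge_sum I (r : seq I) (P : pred I) (F : I -> puiseux k) m :
  (forall i, P i -> ordge m (F i)) -> ordge m (\sum_(i <- r | P i) F i).
Proof.
move=> H; elim/big_ind: _ => //; [exact: ordge0 | by move=> *; exact: ordgeD].
Qed.

Lemma ordgeM m n f g : ordge m f -> ordge n g -> ordge (m + n) (f * g).
Proof. exact: conv_supp. Qed.

Lemma ordgeC (c : k) : ordge 0 (puiseuxC c).
Proof.
move=> q /=; have [->|_] := eqVneq q 0; last by rewrite eqxx.
by exists 0%N; rewrite expo1.
Qed.

Lemma ordge_deriv m f : ordge m f -> ordge (m - 1) (pderiv f).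
Proof.
move=> H; apply/ordgeP => q /=; rewrite mulf_eq0 negb_or => /andP[_].
move/(iffLR (ordgeP m f) H) => [z qE mz]; exists (z - 1); last lia.
by rewrite rmorphB /= -qE addrK.
Qed.

Lemma ordge_lt m f (z : int) : ordge m f -> z < m -> f z%:~R = 0.
Proof.
move=> /ordgeP H zm; apply/eqP; apply: contraT => /H [y /intr_inj <-]; lia.
Qed.

Lemma ordge_succ m f : ordge m f -> f m%:~R = 0 -> ordge (m + 1) f.
Proof.
move=> /ordgeP H fm; apply/ordgeP => q fq; have [z qE mz] := H _ fq.
exists z => //; have : z != m; last by lia.
by apply: contraNneq fq => zm; rewrite qE zm fm.
Qed.

Lemma ordge_coefM m n f g : ordge m f -> ordge n g ->
  (f * g) (m + n)%:~R = f m%:~R * g n%:~R.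
Proof.
move=> Hf Hg; have := @conv_expo k 1 m n f g 0 isT Hf Hg.
by rewrite big_ord1 !expo1 !addr0.
Qed.

Lemma pcoef_deriv f m : (pderiv f) (m - 1)%:~R = m%:~R * f m%:~R.
Proof. by rewrite /= rmorphB /= subrK ratr_int. Qed.

Lemma ordge_eq0 f : (forall i : nat, ordge i%:Z f) -> f = 0.
Proof.
move=> H; apply: puiseux_eqP => q /=; rewrite if_same; apply/eqP.
apply: contraT => fq; have /ordgeP /(_ _ fq) [z qE _] := H 0%N.
by have /ordgeP /(_ _ fq) [y] := H `|z|%N.+1; rewrite qE => /intr_inj <-; lia.
Qed.

Fact mono_subproof (c : k) (m : int) :
  is_puiseux (fun q => if q == m%:~R then c else 0).
Proof.
exists 1%N, m; split=> // q; have [->|_] := eqVneq q; last by rewrite eqxx.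
by exists 0%N; rewrite expo1 addr0.
Qed.

Definition mono c m := Puiseux (mono_subproof c m).

Lemma ordge_mono c m : ordge m (mono c m).
Proof.
apply/ordgeP => q /=; have [->|_] := eqVneq q; last by rewrite eqxx.
by exists m.
Qed.

Lemma pcoef_mono c m : mono c m m%:~R = c.
Proof. by rewrite /= eqxx. Qed.

Lemma pderivC (c : k) : pderiv (puiseuxC c) = 0.
Proof.
apply: puiseux_eqP => q /=; rewrite if_same.
have [->|_] := eqVneq (q + 1) 0; last by rewrite mulr0.
by rewrite -[0]/(0%:~R) ratr_int mul0r.
Qed.

Fact pderiv_is_zmod_morphism : zmod_morphism (@pderiv k).
Proof. by move=> f g; apply: puiseux_eqP => q /=; rewrite mulrBr. Qed.

HB.instance Definition _ :=
  GRing.isZmodMorphism.Build (puiseux k) (puiseux k) (@pderiv k)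
    pderiv_is_zmod_morphism.

Lemma ordge_complete (F : nat -> puiseux k) m :
  (forall j : nat, ordge (m + j%:Z) (F j)) ->
  exists f, forall J : nat, ordge (m + J%:Z) (f - \sum_(j < J) F j).
Proof.
(* Only the [F j] with [m + j <= q] contribute to the coefficient of [t^q]. *)
move=> HF; pose f0 (q : rat) := \sum_(j < `|numq q - m|.+1) F j q.
have sumE (J : nat) q : (\sum_(j < J) F j) q = \sum_(j < J) F j q.
  by elim: J => [|J IH]; rewrite ?big_ord0 ?big_ord_recr /= ?if_same // IH.
have Hf0 q : f0 q != 0 -> exists2 z : int, q = z%:~R & m <= z.
  move=> fq; apply: contrapT => N; case/eqP: fq; apply: big1 => j _.
  apply/eqP; apply: contraT => Fq; case: N.
  have /ordgeP /(_ _ Fq) [z qE mz] := HF j; exists z => //; lia.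
have Pf0 : is_puiseux f0.
  exists 1%N, m; split=> // q /Hf0 [z -> mz]; exists `|z - m|%N.
  by rewrite expo1; congr (_%:~R); lia.
exists (Puiseux Pf0) => J; apply/ordgeP => q /= nz.
have [z qE] : exists z : int, q = z%:~R.
  apply: contrapT => N; case/eqP: nz; rewrite sumE big1 ?subr0.
    apply/eqP; apply: contraT => /Hf0 [z qE _]; case: N; by exists z.
  move=> j _; apply/eqP; apply: contraT => Fq; case: N.
  by have /ordgeP /(_ _ Fq) [z -> _] := HF j; exists z.
exists z => //; rewrite leNgt; apply: contraT => /negPn zJ; case/eqP: nz.
rewrite sumE /f0 qE numq_int.
have stab (n : nat) : z < m + n%:Z -> forall n' : nat, (n <= n')%N ->
    \sum_(j < n') F j z%:~R = \sum_(j < n) F j z%:~R.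
  move=> zn n' /subnKC <-; rewrite -!(big_mkord xpredT (fun j => F j z%:~R)).
  rewrite (@big_cat_nat _ _ _ n) ?leq_addr //= [X in _ + X]big1_seq ?addr0 //.
  move=> j /andP[_]; rewrite mem_index_iota => /andP[nj _].
  by apply: (ordge_lt (HF j)); lia.
case: (leqP J `|z - m|.+1) => h; first by rewrite (stab J) // subrr.
by rewrite [X in _ - X](stab `|z - m|.+1) ?subrr //; lia.
Qed.

End Order.

(** * Orders of matrices and successive approximation *)

Section MatrixOrder.
Variable k : fieldType.
Implicit Types (m n : int).

Definition mordge p q m (X : 'M[puiseux k]_(p, q)) := forall i j, ordge m (X i j).

Section Fixed.
Variables p q : nat.
Implicit Types X Y : 'M[puiseux k]_(p, q).

Lemma mordgeW m n X : n <= m -> mordge m X -> mordge n X.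
Proof. by move=> nm H i j; exact: ordgeW (H i j). Qed.

Lemma mordge0 m : mordge m (0 : 'M[puiseux k]_(p, q)).
Proof. by move=> i j; rewrite mxE; exact: ordge0. Qed.

Lemma mordgeD m X Y : mordge m X -> mordge m Y -> mordge m (X + Y).
Proof. by move=> HX HY i j; rewrite mxE; exact: ordgeD. Qed.

Lemma mordgeN m X : mordge m X -> mordge m (- X).
Proof. by move=> HX i j; rewrite mxE; exact: ordgeN. Qed.

Lemma mordgeB m X Y : mordge m X -> mordge m Y -> mordge m (X - Y).
Proof. by move=> HX HY; apply: mordgeD => //; exact: mordgeN. Qed.

Lemma mordge_sum I (r : seq I) (P : pred I) F m :
  (forall i, P i -> mordge m (F i)) ->
  mordge m (\sum_(i <- r | P i) F i : 'M[puiseux k]_(p, q)).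
Proof.
move=> H; elim/big_ind: _ => //; [exact: mordge0 | by move=> *; exact: mordgeD].
Qed.

Lemma mordgeZ m n c X : ordge m c -> mordge n X -> mordge (m + n) (c *: X).
Proof. by move=> Hc HX i j; rewrite mxE; exact: ordgeM. Qed.

Lemma mordge_deriv m X : mordge m X -> mordge (m - 1) (map_mx (@pderiv k) X).
Proof. by move=> HX i j; rewrite mxE; exact: ordge_deriv. Qed.

Lemma mordge_eq0 X : (forall i : nat, mordge i%:Z X) -> X = 0.
Proof.
by move=> H; apply/matrixP => i j; rewrite mxE; apply: ordge_eq0 => l; exact: H.
Qed.

Lemma mordge_laurent X : (forall i j, laurent (X i j)) -> exists m, mordge m X.
Proof.
move=> H.
have /choice [m Hm] : forall ij : 'I_p * 'I_q, exists m,
    ordge m (X ij.1 ij.2).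
  by move=> [i j]; exact: H.
exists (- \sum_ij `|m ij|) => i j; apply: ordgeW (Hm (i, j)).
rewrite (bigD1 (i, j)) //=; set S := \sum_(_ | _) _.
have : 0 <= S by apply: sumr_ge0 => ? _.
by move: (m (i, j)) S => x S; lia.
Qed.

End Fixed.

Lemma mordgeM p q r m n (X : 'M[puiseux k]_(p, q)) (Y : 'M[puiseux k]_(q, r)) :
  mordge m X -> mordge n Y -> mordge (m + n) (X *m Y).
Proof.
by move=> HX HY i j; rewrite mxE; apply: ordge_sum => l _; exact: ordgeM.
Qed.

Lemma mordge_map p q (X : 'M[k]_(p, q)) : mordge 0 (map_mx (@puiseuxC k) X).
Proof. by move=> i j; rewrite mxE; exact: ordgeC. Qed.

Lemma mordge_delta p q i j : mordge 0 (delta_mx i j : 'M[puiseux k]_(p, q)).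
Proof.
move=> i' j'; rewrite mxE.
by case: (_ && _); [exact: (@ordgeC k 1) | exact: ordge0].
Qed.

Lemma mordge_complete p q (F : nat -> 'M[puiseux k]_(p, q)) m :
  (forall j : nat, mordge (m + j%:Z) (F j)) ->
  exists X, forall J : nat, mordge (m + J%:Z) (X - \sum_(j < J) F j).
Proof.
move=> HF.
have /choice [f Hf] : forall ij : 'I_p * 'I_q, exists f, forall J : nat,
    ordge (m + J%:Z) (f - \sum_(j < J) F j ij.1 ij.2).
  move=> [i j]; apply: (@ordge_complete k (fun l => F l i j) m) => l.
  exact: HF.
exists (\matrix_(i, j) f (i, j)) => J i j.
by rewrite !mxE summxE; exact: (Hf (i, j)).
Qed.

(** Subtracting the image of an approximate preimage of the residual gains one order. The
    corrections sum by completeness, and the bounded loss [K] lets [T] pass to the limit. *)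
Lemma successive_approximation p q
    (T : 'M[puiseux k]_(p, q) -> 'M[puiseux k]_(p, q)) (K c M0 : int) :
  zmod_morphism T ->
  (forall m X, mordge m X -> mordge (m - K) (T X)) ->
  (forall (M : int) Y, M0 <= M -> mordge M Y ->
     exists2 X, mordge (M - c) X & mordge (M + 1) (T X - Y)) ->
  forall (M : int) Y, M0 <= M -> mordge M Y ->
    exists2 X, mordge (M - c) X & T X = Y.
Proof.
move=> Tadd TK HS M Y hM HY.
pose T' : {additive _ -> _} := HB.pack T (GRing.isZmodMorphism.Build _ _ T Tadd).
have TB X X' : T (X - X') = T X - T X' by exact: Tadd.
have Tsum J (F : nat -> _) : T (\sum_(j < J) F j) = \sum_(j < J) T (F j).
  exact: (raddf_sum T').
have /choice [S SP] : forall z : int * 'M[puiseux k]_(p, q), exists X,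
    M0 <= z.1 -> mordge z.1 z.2 ->
    mordge (z.1 - c) X /\ mordge (z.1 + 1) (T X - z.2).
  move=> [m Z] /=.
  have [[hm HZ]|N] := pselect (M0 <= m /\ mordge m Z).
    by have [X HX1 HX2] := HS _ _ hm HZ; exists X.
  by exists 0 => hm HZ; case: N.
(* [W j] is the residual left after [j] corrections. *)
pose W := fix W (j : nat) :=
  if j is j'.+1 then W j' - T (S (M + j'%:Z, W j')) else Y.
have HW (j : nat) : mordge (M + j%:Z) (W j).
  elim: j => [|j IH]; first by rewrite addr0.
  have [|_ /mordgeN] := SP (M + j%:Z, W j) _ IH; first by rewrite /=; lia.
  by rewrite opprB /= -addn1 PoszD addrA.
pose F j := S (M + j%:Z, W j).
have HF (j : nat) : mordge (M - c + j%:Z) (F j).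
  have [|+ _] := SP (M + j%:Z, W j) _ (HW j); first by rewrite /=; lia.
  by rewrite addrAC.
have [X HX] := mordge_complete HF; exists X.
  have -> : X = X - \sum_(j < 0) F j by rewrite big_ord0 subr0.
  by apply: mordgeW (HX 0%N); lia.
have TF J : T (\sum_(j < J) F j) = Y - W J.
  rewrite Tsum; elim: J => [|J IH]; first by rewrite big_ord0 subrr.
  by rewrite big_ord_recr /= IH opprB [T _ - _]addrC addrA.
apply/eqP; rewrite -subr_eq0; apply/eqP; apply: mordge_eq0 => i.
(* Large enough that both the image of the tail and the residual [W J] have order at least [i]. *)
pose J := (i + `|M| + `|c| + `|K|)%N.
have -> : T X - Y = T (X - \sum_(j < J) F j) - W J.
  by by rewrite TB TF opprB addrA addrAC addrK.
apply: mordgeB; last by apply: mordgeW (HW J); lia.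
by apply: mordgeW (TK _ _ (HX J)); lia.
Qed.

End MatrixOrder.

(** * Linear relations and indicial polynomials *)

Section Dependence.
Variable k : fieldType.

Let integral (q : rat) := `[< exists z : int, q = z%:~R >].

Fact laurent_part_subproof (q0 : rat) (f : puiseux k) :
  exists v : int, supp_in 1 v (fun r => if integral r then f (r + q0) else 0).
Proof.
(* A crude bound: exponents of [f] are at least [v / b >= - |v|], and [q0] is at most
   [|numq q0|]. *)
have [b [v [b0 sf]]] := pcoefP f; exists (- `|v| - `|numq q0|) => q.
rewrite /integral; case: asboolP => [[z ->]|_]; last by rewrite eqxx.
move=> /sf [m E]; exists `|(z + `|v| + `|numq q0|)%R|%N; rewrite expo1.
congr (_%:~R); suff : - `|v| - `|numq q0| <= z by lia.
rewrite -(ler_int rat) rmorphB rmorphN /=.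
have -> : z%:~R = expo b v m - q0 by rewrite -E addrK.
apply: lerB.
  rewrite /expo ler_pdivlMr ?ltr0n //.
  apply: (@le_trans _ _ (v%:~R)); last by rewrite lerDl ler0n.
  apply: (@le_trans _ _ (- `|v|)%:~R); last by rewrite ler_int; lia.
  by rewrite -[b%:R]/(b%:Z%:~R) -rmorphN -rmorphM /= ler_int; nia.
rewrite -[leLHS]divq_num_den ler_pdivrMr ?ltr0z ?denq_gt0 //.
rewrite -rmorphM /= ler_int; have := denq_gt0 q0.
by move: (numq q0) (denq q0) => x y; nia.
Qed.

Fact laurent_part_puiseux (q0 : rat) (f : puiseux k) :
  is_puiseux (fun r => if integral r then f (r + q0) else 0).
Proof. by have [v] := laurent_part_subproof q0 f; exists 1%N, v. Qed.

(* The part of [t^-q0 f] with integral exponents; for fixed [q0] this is a map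
   linear over the Laurent series. *)
Definition laurent_part q0 f := Puiseux (laurent_part_puiseux q0 f).

Lemma laurent_laurent_part q0 f : laurent (laurent_part q0 f).
Proof. exact: laurent_part_subproof. Qed.

Lemma coef_laurent_part q0 f (z : int) : laurent_part q0 f z%:~R = f (z%:~R + q0).
Proof. by rewrite /= /integral; case: asboolP => // -[]; exists z. Qed.

(** A Laurent factor preserves classes of exponents modulo the integers, so only the part of [f] in
    the class of [q0] contributes. *)
Lemma laurent_partM q0 f g (z : int) : laurent g ->
  (laurent_part q0 f * g) z%:~R = (f * g) (z%:~R + q0).
Proof.
move=> [v /ordgeP Hg]; rewrite /= /conv.
rewrite [RHS](@reindex_fsbigT _ _ _ _ _ (fun r => r + q0)) /=; last first.
  exists (fun r => r - q0) => r; rewrite ?addrK ?subrK //.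
apply: eq_fsbigr => r _; rewrite opprD addrACA subrr addr0.
rewrite /integral; case: asboolP => // N; rewrite mul0r.
have [->|/Hg [y yE _]] := eqVneq (g (z%:~R - r)) 0.
  by rewrite mulr0.
by case: N; exists (z - y); rewrite rmorphB /= -yE opprB addrC subrK.
Qed.

Lemma laurentM (f g : puiseux k) : laurent f -> laurent g -> laurent (f * g).
Proof. by move=> [v Hf] [w Hg]; exists (v + w); exact: ordgeM. Qed.

Lemma laurent_sum I (r : seq I) (P : pred I) (F : I -> puiseux k) :
  (forall i, P i -> laurent (F i)) -> laurent (\sum_(i <- r | P i) F i).
Proof.
move=> H; elim/big_ind: _ => //; first by exists 0; exact: ordge0.
move=> f g [v Hf] [w Hg]; exists (Num.min v w).
by apply: ordgeD; [apply: ordgeW Hf | apply: ordgeW Hg]; rewrite ge_min lexx ?orbT.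
Qed.

Lemma pcoef_sum I (r : seq I) (P : pred I) (F : I -> puiseux k) q :
  (\sum_(i <- r | P i) F i) q = \sum_(i <- r | P i) F i q.
Proof.
by apply: (big_morph (fun f : puiseux k => f q)) => //=; rewrite if_same.
Qed.

(** A relation over the field of Puiseux series exists by dimension. Projecting it to one class of
    exponents modulo the integers makes its coefficients Laurent. *)
Lemma laurent_dependence p q D (e : 'I_D -> 'M[puiseux k]_(p, q)) :
  (p * q < D)%N -> (forall l i j, laurent (e l i j)) ->
  exists a : 'I_D -> puiseux k,
    [/\ exists l, a l != 0, forall l, laurent (a l) & \sum_l a l *: e l = 0].
Proof.
move=> pqD Le.
have [a [l al] Ea] : exists2 a : 'I_D -> puiseux k,
    exists l, a l != 0 & \sum_l a l *: e l = 0.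
  have /freeP N : ~~ free [tuple e l | l < D].
    apply/negP => /eqP; rewrite size_tuple => dimE.
    have := dimvS (subvf <<[tuple e l | l < D]>>%VS).
    by rewrite dimE dimvf /dim /= leqNgt pqD.
  apply: contrapT => N'; apply: N => a Ea l; apply/eqP; apply: contraT => al.
  case: N'; exists a; first by exists l.
  rewrite -[RHS]Ea; apply: eq_bigr => i _.
  by rewrite (nth_map i) ?size_enum_ord // nth_ord_enum.
(* Taking [q0] in the support of a nonzero coefficient keeps the projected relation nontrivial. *)
have [q0 aq0] : exists q0, a l q0 != 0.
  apply: contrapT => N; case/eqP: al; apply: puiseux_eqP => r /=; rewrite if_same.
  by apply/eqP; apply: contraT => ar; case: N; exists r.
exists (fun l => laurent_part q0 (a l)); split.
- exists l; apply: contraNneq aq0 => /(congr1 (fun f : puiseux k => f 0%:~R)).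
  by rewrite coef_laurent_part add0r => ->; rewrite /= ?if_same.
- by move=> l'; exact: laurent_laurent_part.
apply/matrixP => i j; rewrite summxE mxE; set f := \sum_ _ _.
have [v /ordgeP Lf] : laurent f.
  apply: laurent_sum => l' _; rewrite mxE.
  by apply: laurentM => //; exact: laurent_laurent_part.
apply: puiseux_eqP => r /=; rewrite if_same; apply/eqP; apply: contraT => fr.
have [z rE _] := Lf _ fr; case/eqP: fr.
rewrite rE pcoef_sum.
under eq_bigr => l' _ do rewrite mxE laurent_partM //.
have /matrixP /(_ i j) := Ea; rewrite summxE mxE.
move/(congr1 (fun f : puiseux k => f (z%:~R + q0))); rewrite pcoef_sum /= if_same.
by under eq_bigr do rewrite mxE.
Qed.

(* The leading exponent [p] of the scalar differential operator
   [\sum_l a_l (d/dt)^l], in which [(d/dt)^l] lowers exponents by [l]. *)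
Lemma leading_exponent D (a : 'I_D -> puiseux k) :
  (forall l, laurent (a l)) -> (exists l, a l != 0) ->
  exists p : int, (forall l : 'I_D, ordge (p + l%:Z) (a l)) /\
    exists l : 'I_D, a l (p + l%:Z)%:~R != 0.
Proof.
move=> La [l0 al0].
have /choice [m Hm] : forall l, exists m, ordge m (a l) by exact: La.
pose B : int := - \sum_l (`|m l| + l%:Z).
pose P (n : nat) := forall l : 'I_D, ordge (B + n%:Z + l%:Z) (a l).
have P0 : P 0%N.
  move=> l; apply: ordgeW (Hm l); rewrite /B (bigD1 l) //=.
  set S := \sum_(_ | _) _.
  have : 0 <= S by apply: sumr_ge0 => ? _.
  by move: (m l) S => x S; lia.
(* [P] cannot hold for all [n], since [a l0] would then have infinite order. At the last valid [n]
   some leading coefficient is nonzero. *)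
have [n [Pn PSn]] : exists n, P n /\ ~ P n.+1.
  apply: contrapT => N; have Pall n : P n.
    elim: n => // n IH; apply: contrapT => h; apply: N; by exists n.
  case/eqP: al0; apply: ordge_eq0 => i; apply: ordgeW (Pall (i + `|B|)%N l0); lia.
exists (B + n%:Z); split=> //; apply: contrapT => N; apply: PSn => l.
have -> : B + n.+1%:Z + l%:Z = B + n%:Z + l%:Z + 1 by lia.
by apply: ordge_succ => //; apply/eqP; apply: contraT => h; case: N; exists l.
Qed.

Hypothesis char0 : [pchar k] =i pred0.

(** Integral roots are divided out one at a time, lowering the degree; distinct integers stay
    distinct in [k]. *)
Lemma int_root_bound (P : {poly k}) : P != 0 ->
  exists s0 : nat, forall s : int, s0%:Z <= s -> P.[s%:~R] != 0.
Proof.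
have [n] := ubnP (size P); elim: n P => // n IH P sP P0.
have [[s /eqP rs]|N] := pselect (exists s : int, P.[s%:~R] == 0); last first.
  by exists 0%N => s _; apply/negP => rs; apply: N; exists s.
have /factor_theorem [Q PE] : root P s%:~R by apply/eqP.
have Q0 : Q != 0 by apply: contraNneq P0 => Q0; rewrite PE Q0 mul0r.
have [|s0 Hs0] := IH Q _ Q0.
  by move: sP; rewrite PE size_Mmonic ?monicXsubC // size_XsubC addn2 ltnS.
exists (s0 + `|s|.+1)%N => s' hs'; rewrite PE hornerM hornerXsubC mulf_neq0 //.
  by apply: Hs0; lia.
by rewrite -rmorphB /= intr_eq0_pchar0 //; lia.
Qed.

(** The [P l] have distinct degrees, so in the combination the top coefficient for the largest [l]
    with [b l != 0] cannot cancel. *)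
Lemma indicial D (b : 'I_D -> k) (P : 'I_D -> {poly k}) :
  (forall l, size (P l) = l.+1) -> (exists l, b l != 0) ->
  exists s0 : nat, forall s : int, s0%:Z <= s ->
    \sum_l b l * (P l).[s%:~R] != 0.
Proof.
move=> sP [l0 bl0].
have [|s0 Hs0] := @int_root_bound (\sum_l b l *: P l); last first.
  exists s0 => s /Hs0; rewrite horner_sum.
  by under eq_bigr do rewrite hornerZ.
case: (@Order.TotalTheory.arg_maxP _ _ _ l0 (fun l => b l != 0)
  (fun l => l : nat) bl0).
move=> l bl lmax; apply: contraTneq bl => /(congr1 (fun Q : {poly k} => Q`_l)).
rewrite coef_sum coef0 (bigD1 l) //= big1 => [|l' l'l]; last first.
  rewrite coefZ; have [->|bl'] := eqVneq (b l') 0; first by rewrite mul0r.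
  have : (l' <= l)%N by exact: lmax.
  rewrite leq_eqVlt => /orP[/eqP /val_inj lE|ll].
    by rewrite lE eqxx in l'l.
  by rewrite nth_default ?mulr0 // sP.
rewrite addr0 coefZ => /eqP; rewrite mulf_eq0.
have -> : (P l)`_l = lead_coef (P l) by rewrite lead_coefE sP.
rewrite lead_coef_eq0 -size_poly_eq0 sP orbF => /eqP ->; by rewrite eqxx.
Qed.

End Dependence.

(** * Formal connections on lattices of high order *)

Section Connections.
Variable k : fieldType.
Hypothesis char0 : [pchar k] =i pred0.
Implicit Types (f g : puiseux k).

(* [(d/dt)^l t^(s+c) = (fallp c l).[s] t^(s+c-l)] *)
Definition fallp (c : int) (l : nat) : {poly k} :=
  \prod_(i < l) ('X - ((i%:Z - c)%:~R)%:P).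

Lemma size_fallp c l : size (fallp c l) = l.+1.
Proof. by rewrite size_prod_XsubC /index_enum -enumT size_enum_ord. Qed.

Lemma horner_fallp c l (s : int) :
  (fallp c l).[s%:~R] = \prod_(i < l) (s + c - i%:Z)%:~R.
Proof.
rewrite horner_prod; apply: eq_bigr => i _.
by rewrite hornerXsubC -rmorphB /= opprB addrA.
Qed.

Lemma ordge_iter_deriv l m f :
  ordge m f -> ordge (m - l%:Z) (iter l (@pderiv k) f).
Proof.
move=> Hf; elim: l => [|l IH]; first by rewrite subr0.
by rewrite /= (_ : m - l.+1%:Z = m - l%:Z - 1); [exact: ordge_deriv | lia].
Qed.

Lemma coef_iter_deriv c l (s : int) f :
  (iter l (@pderiv k) f) (s + c - l%:Z)%:~R = (fallp c l).[s%:~R] * f (s + c)%:~R.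
Proof.
rewrite horner_fallp; elim: l => [|l IH]; first by rewrite subr0 big_ord0 mul1r.
rewrite iterS (_ : s + c - l.+1%:Z = s + c - l%:Z - 1); last lia.
by rewrite pcoef_deriv IH big_ord_recr /= mulrA [_ * \prod_(_ < _) _]mulrC.
Qed.

Section Surjectivity.
Variables (p q : nat) (nabla : 'M[puiseux k]_(p, q) -> 'M[puiseux k]_(p, q)).
Variable K : nat.
Hypothesis nabla_zmod : zmod_morphism nabla.
Hypothesis nablaZ : forall c X, nabla (c *: X) = pderiv c *: X + c *: nabla X.
Hypothesis nabla_ord : forall m X, mordge m X -> mordge (m - K%:Z) (nabla X).

HB.instance Definition _ :=
  GRing.isZmodMorphism.Build _ _ nabla nabla_zmod.

(* Leibniz' rule gives [(d/dt)^l g e = nabla (Q_l g) + g eps_l], where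
   [eps_l = (- nabla)^l e].  A linear relation [\sum_l a_l eps_l = 0] yields
   [nabla (\sum_l Q_l (a_l f)) = L f e] with [L f = \sum_l (d/dt)^l (a_l f)] a
   nonzero scalar operator, whose indicial polynomial has no large root. *)
Lemma approx_surjective1 (e : 'M[puiseux k]_(p, q)) : mordge 0 e ->
  exists c s0 : nat, forall (M : int) g, s0%:Z <= M -> ordge M g ->
    exists2 X, mordge (M - c%:Z) X & mordge (M + 1) (nabla X - g *: e).
Proof.
move=> He; pose eps l := iter l (fun X => - nabla X) e.
have Heps (l : nat) : mordge (- (l * K)%N%:Z) (eps l).
  elim: l => [|l IH]; first exact: mordgeW He.
  apply: mordgeN; apply: mordgeW (nabla_ord IH); lia.
pose Q := fix Q l g := if l is l'.+1 then Q l' (pderiv g) + g *: eps l' else 0.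
have QP l g : iter l (@pderiv k) g *: e = nabla (Q l g) + g *: eps l.
  elim: l g => [|l IH] g; first by rewrite raddf0 add0r.
  by rewrite iterSr IH /= raddfD /= nablaZ scalerN addrA addrK.
have QO (l : nat) g m : ordge m g -> mordge (m - (l + l * K)%N%:Z) (Q l g).
  elim: l g m => [|l IH] g m Hg; first exact: mordge0.
  apply: mordgeD; first by apply: mordgeW (IH _ _ (ordge_deriv Hg)); lia.
  by apply: mordgeW (mordgeZ Hg (Heps l)); lia.
have [|a [an0 La Ea]] := @laurent_dependence k p q (p * q).+1 eps (leqnn _).
  by move=> l i j; exists (- (l * K)%N%:Z); exact: Heps.
have [p0 [Ha bn0]] := leading_exponent La an0.
pose b (l : 'I_(p * q).+1) := a l (p0 + l%:Z)%:~R.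
(* The shift [p0 + l] appears because multiplication by [a l] precedes the differentiation. *)
have [|s0 Hs0] := @indicial k char0 _ b (fun l => fallp (p0 + l%:Z) l) _ bn0.
  by move=> l; exact: size_fallp.
(* The first constant bounds the order lost by [Q l] for all [l] in the relation; the second ensures
   [M - p0 >= s0]. *)
exists ((p * q).+1 * K)%N, (s0 + `|p0|)%N => M g hM Hg.
have {}Hs0 := Hs0 (M - p0) ltac:(lia).
set chi := \sum_l _ in Hs0.
(* Dividing by the indicial value [chi] gives [h] the same coefficient at [t^M] as [g]. *)
pose f := mono (g M%:~R / chi) (M - p0).
have Hf : ordge (M - p0) f by exact: ordge_mono.
have Haf (l : 'I_(p * q).+1) : ordge (M + l%:Z) (a l * f).
  by rewrite (_ : M + l%:Z = p0 + l%:Z + (M - p0)); [exact: ordgeM | lia].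
exists (\sum_(l < (p * q).+1) Q l (a l * f)).
  apply: mordge_sum => l _; apply: mordgeW (QO l _ _ (Haf l)).
  by have := leq_mul (ltnW (ltn_ord l)) (leqnn K); lia.
pose h := \sum_(l < (p * q).+1) iter l (@pderiv k) (a l * f).
have -> : nabla (\sum_(l < (p * q).+1) Q l (a l * f)) = h *: e.
  rewrite raddf_sum /= scaler_suml.
  under [RHS]eq_bigr do rewrite QP.
  rewrite big_split /= -[LHS]addr0; congr (_ + _).
  under eq_bigr do rewrite mulrC -scalerA.
  by rewrite -scaler_sumr Ea scaler0.
rewrite -scalerBl -[M + 1]addr0; apply: mordgeZ => //; apply: ordge_succ.
  apply: ordgeB => //; apply: ordge_sum => l _.
  by apply: ordgeW (ordge_iter_deriv (Haf l)); lia.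
rewrite /= pcoef_sum; apply/eqP; rewrite subr_eq0; apply/eqP.
transitivity (chi * f (M - p0)%:~R); last by rewrite pcoef_mono mulrC divfK.
rewrite mulr_suml; apply: eq_bigr => l _.
have -> : M = (M - p0) + (p0 + l%:Z) - l%:Z by lia.
rewrite coef_iter_deriv [_ + (p0 + _)]addrC ordge_coefM //.
rewrite (_ : p0 + l%:Z + (M - p0) - l%:Z - p0 = M - p0); last by lia.
by rewrite mulrA [b l * _]mulrC.
Qed.

(** The target splits along the matrix units, each handled by the previous lemma; sums of the
    individual constants are common bounds. *)
Lemma approx_surjective :
  exists c s0 : nat, forall (M : int) Y, s0%:Z <= M -> mordge M Y ->
    exists2 X, mordge (M - c%:Z) X & mordge (M + 1) (nabla X - Y).
Proof.
have /choice [cs Hcs] : forall ij : 'I_p * 'I_q, exists cs : nat * nat,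
    forall (M : int) g, cs.2%:Z <= M -> ordge M g ->
    exists2 X, mordge (M - cs.1%:Z) X &
      mordge (M + 1) (nabla X - g *: delta_mx ij.1 ij.2).
  move=> [i j] /=; have [c [s0 H]] := approx_surjective1 (@mordge_delta k p q i j).
  by exists (c, s0).
exists (\sum_ij (cs ij).1)%N, (\sum_ij (cs ij).2)%N => M Y hM HY.
have le_sum (F : 'I_p * 'I_q -> nat) ij : (F ij <= \sum_ij F ij)%N.
  by rewrite (bigD1 ij) //= leq_addr.
have /choice [X HX] : forall ij, exists X, mordge (M - (cs ij).1%:Z) X /\
      mordge (M + 1) (nabla X - Y ij.1 ij.2 *: delta_mx ij.1 ij.2).
  move=> ij; have [||X HX1 HX2] := Hcs ij M (Y ij.1 ij.2); last by exists X.
    by apply: le_trans hM; rewrite lez_nat; exact: (le_sum (fun ij => (cs ij).2)).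
  exact: HY.
exists (\sum_ij X ij).
  apply: mordge_sum => ij _; apply: mordgeW (proj1 (HX ij)).
  by rewrite lerB // lez_nat; exact: (le_sum (fun ij => (cs ij).1)).
have -> : Y = \sum_ij Y ij.1 ij.2 *: delta_mx ij.1 ij.2.
  by rewrite {1}[Y]matrix_sum_delta pair_bigA.
rewrite raddf_sum /= -sumrB; apply: mordge_sum => ij _; exact: (proj2 (HX ij)).
Qed.

End Surjectivity.

Lemma pderiv_mulmx p q r (X : 'M[puiseux k]_(p, q)) (Y : 'M[puiseux k]_(q, r)) :
  map_mx (@pderiv k) (X *m Y) =
  map_mx (@pderiv k) X *m Y + X *m map_mx (@pderiv k) Y.
Proof.
apply/matrixP => i j; rewrite !mxE raddf_sum /= -big_split /=.
by apply: eq_bigr => l _; rewrite pderivM // !mxE.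
Qed.

(* Dual to [approx_surjective1]: with [u_(l+1) = B u_l + u_l'], the derivative
   [(d/dt)^l (v u_0)] is [v u_l] up to derivatives of [w = v' - v B], and a linear
   relation between the [u_l] gives a scalar equation for [v u_0]. *)
Lemma approx_injective1 r (B : 'M[puiseux k]_r) (K : nat)
    (u0 : 'cV[puiseux k]_r) :
  mordge (- K%:Z) B -> mordge 0 u0 ->
  exists c s0 : nat, forall (m : int) (v : 'rV[puiseux k]_r), s0%:Z <= m ->
    mordge m v -> mordge (m + c%:Z) (map_mx (@pderiv k) v - v *m B) ->
    ordge (m + 1) ((v *m u0) 0 0).
Proof.
move=> HB Hu0; pose u l := iter l (fun U => B *m U + map_mx (@pderiv k) U) u0.
have Hu (l : nat) : mordge (- (l * K.+1)%N%:Z) (u l).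
  elim: l => [|l IH]; first exact: mordgeW Hu0.
  apply: mordgeD; first by apply: mordgeW (mordgeM HB IH); lia.
  by apply: mordgeW (mordge_deriv IH); lia.
have [|a [an0 La Ea]] := @laurent_dependence k r 1 (r * 1).+1 u (leqnn _).
  by move=> l i j; exists (- (l * K.+1)%N%:Z); exact: Hu.
have [p0 [Ha bn0]] := leading_exponent La an0.
pose b (l : 'I_(r * 1).+1) := a l (p0 + l%:Z)%:~R.
(* No shift this time: differentiation precedes multiplication by [a l]. *)
have [|s0 Hs0] := @indicial k char0 _ b (fun l => fallp 0 l) _ bn0.
  by move=> l; exact: size_fallp.
(* The order lost in [err l] stays below this constant for every [l] in the relation, so the terms
   [a l * err l] start beyond [t^(p0 + m)]. *)
exists ((r * 1).+1 * K.+1).+1, s0 => m v hm Hv; set w := _ - _ => Hw.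
pose err := fix err l := if l is l'.+1 then
  pderiv (err l') + (w *m u l') 0 0 else 0.
have errP l : iter l (@pderiv k) ((v *m u0) 0 0) = (v *m u l) 0 0 + err l.
  elim: l => [|l IH]; first by rewrite addr0.
  rewrite iterS IH raddfD /= [pderiv (err l) + _]addrC addrA; congr (_ + _).
  have -> : pderiv ((v *m u l) 0 0) = (map_mx (@pderiv k) (v *m u l)) 0 0.
    by rewrite [RHS]mxE.
  transitivity ((v *m u l.+1 + w *m u l) 0 0); last by rewrite mxE.
  congr (fun_of_matrix _ 0 0); rewrite pderiv_mulmx /= mulmxDr mulmxA mulmxBl.
  by rewrite [RHS]addrC addrA subrK.
have errO (l : nat) :
    ordge (m + ((r * 1).+1 * K.+1).+1%:Z - (l * K.+1)%N%:Z) (err l).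
  elim: l => [|l IH]; first exact: ordge0.
  apply: ordgeD; first by apply: ordgeW (ordge_deriv IH); lia.
  by have H := mordgeM Hw (Hu l); apply: ordgeW (H 0 0); lia.
set y := (v *m u0) 0 0 in errP *.
have Hy : ordge m y by have H := mordgeM Hv Hu0; apply: ordgeW (H 0 0); lia.
apply: ordge_succ => //.
have E : \sum_l a l * iter l (@pderiv k) y = \sum_l a l * err l.
  under eq_bigr do rewrite errP mulrDr.
  rewrite big_split /= [X in X + _](_ : _ = 0) ?add0r //.
  transitivity ((v *m \sum_l a l *: u l) 0 0); last by rewrite Ea mulmx0 mxE.
  by rewrite mulmx_sumr summxE; apply: eq_bigr => l _; rewrite -scalemxAr [RHS]mxE.
(* At this exponent the left side is the indicial value at [m] times the coefficient of [y] at
   [t^m], which must therefore vanish. *)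
have {E} : (\sum_l a l * iter l (@pderiv k) y) (p0 + m)%:~R = 0.
  rewrite E; apply: (@ordge_lt _ (p0 + m + 1)); last lia.
  apply: ordge_sum => l _; apply: ordgeW (ordgeM (Ha l) (errO l)).
  by have := leq_mul (ltnW (ltn_ord l)) (leqnn K.+1); lia.
rewrite pcoef_sum => E.
have /eqP : (\sum_l b l * (fallp 0 l).[m%:~R]) * y m%:~R = 0.
  rewrite -[RHS]E mulr_suml; apply: eq_bigr => l _.
  rewrite (_ : p0 + m = p0 + l%:Z + (m - l%:Z)); last lia.
  rewrite ordge_coefM //; last exact: ordge_iter_deriv.
  by have := coef_iter_deriv 0 l m y; rewrite !addr0 => ->; rewrite mulrA.
by rewrite mulf_eq0 (negPf (Hs0 m hm)) => /eqP.
Qed.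

Lemma approx_injective r (B : 'M[puiseux k]_r) (K : nat) : mordge (- K%:Z) B ->
  exists c s0 : nat, forall (m : int) (v : 'rV[puiseux k]_r), s0%:Z <= m ->
    mordge m v -> mordge (m + c%:Z) (map_mx (@pderiv k) v - v *m B) ->
    mordge (m + 1) v.
Proof.
move=> HB.
have /choice [cs Hcs] : forall j : 'I_r, exists cs : nat * nat,
    forall (m : int) (v : 'rV[puiseux k]_r), cs.2%:Z <= m -> mordge m v ->
    mordge (m + cs.1%:Z) (map_mx (@pderiv k) v - v *m B) -> ordge (m + 1) (v 0 j).
  move=> j; have [c [s0 H]] := approx_injective1 HB (@mordge_delta k r 1 j 0).
  exists (c, s0) => m v /= hm Hv Hw; have := H m v hm Hv Hw.
  by rewrite -colE mxE.
have le_sum (F : 'I_r -> nat) j : (F j <= \sum_j F j)%N.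
  by rewrite (bigD1 j) //= leq_addr.
exists (\sum_j (cs j).1)%N, (\sum_j (cs j).2)%N => m v hm Hv Hw i j.
rewrite ord1; apply: Hcs => //.
  by apply: le_trans hm; rewrite lez_nat; exact: (le_sum (fun j => (cs j).2)).
by apply: mordgeW Hw; rewrite lerD2l lez_nat; exact: (le_sum (fun j => (cs j).1)).
Qed.

End Connections.

(** * Hilbert's basis theorem *)

Section HilbertBasis.

(** [g i] is an index from [i] on where [f] attains its minimum over that tail; [sigma] jumps from
    one such index to the next. *)
Lemma nondecreasing_subsequence (f : nat -> nat) : exists sigma : nat -> nat,
  (forall i, sigma i < sigma i.+1)%N /\
  forall i, (f (sigma i) <= f (sigma i.+1))%N.
Proof.
have /choice [g Hg] : forall i, exists j, (i <= j)%N /\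
    forall j', (i <= j')%N -> (f j <= f j')%N.
  move=> i; have ex : exists y, `[< exists2 j, (i <= j)%N & f j = y >].
    by exists (f i); apply/asboolP; exists i.
  have [y /asboolP [j ij fj] ymin] := ex_minnP ex; exists j; split=> // j' ij'.
  by rewrite fj; apply: ymin; apply/asboolP; exists j'.
pose sigma := fix sigma i := if i is i'.+1 then g (sigma i').+1 else g 0%N.
exists sigma; split=> i; first by have [] := Hg (sigma i).+1.
have lt_sigma : (sigma i < sigma i.+1)%N by have [] := Hg (sigma i).+1.
case: i lt_sigma => [|i] lt_sigma; first by apply: (proj2 (Hg _)).
apply: (proj2 (Hg _)); apply: leq_trans (ltnW lt_sigma).
by have [] := Hg (sigma i).+1.
Qed.

(** Subsequences are extracted one coordinate after another; the first two terms of the final one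
    are comparable. *)
Lemma dickson n (u : nat -> 'X_{1..n}) : exists i j, (i < j)%N /\ (u i <= u j)%MM.
Proof.
suff [sigma [inc Hs]] : exists sigma : nat -> nat,
    (forall i, sigma i < sigma i.+1)%N /\
    forall c i, c \in enum 'I_n -> (u (sigma i) c <= u (sigma i.+1) c)%N.
  exists (sigma 0%N), (sigma 1%N); split=> //; apply/mnm_lepP => c.
  by apply: Hs; rewrite mem_enum.
elim: (enum 'I_n) => [|c s [sigma [inc Hs]]]; first by exists id; split.
have [tau [tinc Ht]] := nondecreasing_subsequence (fun i => u (sigma i) c).
exists (sigma \o tau); split=> [i|c' i] /=.
  by apply: (homo_ltn ltn_trans inc).
rewrite inE => /predU1P [-> //|c's].
apply: (homo_leq (f := fun i => u (sigma i) c') leqnn leq_trans _ (ltnW (tinc i))).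
by move=> j; exact: Hs.
Qed.

Variables (k : fieldType) (n : nat).
Implicit Types (p q : {mpoly k[n]}) (s : seq {mpoly k[n]}).

Definition ideal_span s p :=
  exists h : nat -> {mpoly k[n]}, p = \sum_(i < size s) h i * s`_i.

Lemma ideal_span0 s : ideal_span s 0.
Proof. by exists (fun=> 0); rewrite big1 // => i _; rewrite mul0r. Qed.

Lemma ideal_spanD s p q : ideal_span s p -> ideal_span s q -> ideal_span s (p + q).
Proof.
move=> [h ->] [h' ->]; exists (fun i => h i + h' i); rewrite -big_split /=.
by apply: eq_bigr => i _; rewrite mulrDl.
Qed.

Lemma ideal_spanM s p q : ideal_span s q -> ideal_span s (p * q).
Proof.
move=> [h ->]; exists (fun i => p * h i); rewrite mulr_sumr.
by apply: eq_bigr => i _; rewrite mulrA.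
Qed.

Lemma mem_ideal_span s p : p \in s -> ideal_span s p.
Proof.
move=> ps; exists (fun i => (i == index p s)%:R).
have lt_idx : (index p s < size s)%N by rewrite index_mem.
rewrite (bigD1 (Ordinal lt_idx)) //= eqxx mul1r nth_index // big1 ?addr0 //.
by move=> i /negPf ni; rewrite -(inj_eq val_inj) /= in ni; rewrite ni mul0r.
Qed.

Variable I : set {mpoly k[n]}.
Hypothesis ID : forall p q, I p -> I q -> I (p + q).
Hypothesis IM : forall p q, I q -> I (p * q).

(** Otherwise one can forever adjoin an element of [I] outside the span, with minimal leading
    monomial. By Dickson's lemma an earlier leading monomial divides a later one, and cancelling the
    leading term contradicts minimality. *)
Theorem hilbert_basis : exists2 s,
  forall p, p \in s -> I p & forall p, I p -> ideal_span s p.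
Proof.
apply: contrapT => nfg.
have /choice [next Hnext] : forall s, exists p, (forall x, x \in s -> I x) ->
    [/\ I p, ~ ideal_span s p &
      forall q, I q -> (mlead q < mlead p)%O -> ideal_span s q].
  move=> s; have [Is|N] := pselect (forall x, x \in s -> I x); last by exists 0.
  apply: contrapT => N; apply: nfg; exists s => // p.
  elim/mleadrect: p => p IH Ip; apply: contrapT => Np; apply: N; exists p => _.
  by split=> // q Iq qp; exact: IH.
pose S := fix S i := if i is i'.+1 then rcons (S i') (next (S i')) else [::].
have SI i : forall x, x \in S i -> I x.
  elim: i => // i IH x; rewrite /= mem_rcons inE => /predU1P [->|/IH //].
  by have [] := Hnext _ IH.
pose P i := next (S i).
have PS i j : (i < j)%N -> P i \in S j.
  elim: j => // j IH; rewrite ltnS leq_eqVlt => /predU1P [->|/IH H].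
    by rewrite /= mem_rcons mem_head.
  by rewrite /= mem_rcons inE H orbT.
have P0 i : P i != 0.
  have [_ N _] := Hnext _ (SI i); apply: contra_notN N => /eqP.
  by rewrite -/(P i) => ->; exact: ideal_span0.
have [i [j [ij le_ij]]] := dickson (fun i => mlead (P i)).
have [IPj NPj minPj] := Hnext _ (SI j); rewrite -/(P j) in IPj NPj minPj.
have [IPi _ _] := Hnext _ (SI i); rewrite -/(P i) in IPi.
pose c := mleadc (P j) / mleadc (P i).
have c0 : c != 0 by rewrite mulf_neq0 ?invr_eq0 ?mleadc_eq0.
pose m := (c *: 'X_[mlead (P j) - mlead (P i)]) : {mpoly k[n]}.
have leadm : mlead m = (mlead (P j) - mlead (P i))%MM by rewrite mleadZ // mleadXm.
have m0 : m != 0 by rewrite -mleadc_eq0 leadm mcoeffZ mcoeffX eqxx mulr1.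
have leadmP : mlead (m * P i) = mlead (P j) by rewrite mleadM // leadm submK.
pose q := P j - m * P i.
have Iq : I q by rewrite /q -mulNr; apply: ID => //; exact: IM.
have Nq : ~ ideal_span (S j) q.
  move=> Hq; apply: NPj; rewrite -[P j](subrK (m * P i)); apply: ideal_spanD => //.
  by apply: ideal_spanM; apply: mem_ideal_span; exact: PS.
apply: Nq; have [->|q0] := eqVneq q 0; first exact: ideal_span0.
apply: minPj => //; rewrite lt_neqAle; apply/andP; split; last first.
  by apply: le_trans (mleadB_le _ _) _; rewrite leadmP joinxx.
apply: contraNneq q0 => lead_eq; rewrite -mleadc_eq0 lead_eq mcoeffB.
rewrite -{2}leadmP mleadM // mleadcM leadm mcoeffZ mcoeffX eqxx mulr1.
by rewrite divfK ?mleadc_eq0 // subrr.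
Qed.

End HilbertBasis.

(** * Invariant derivations of the coordinate ring *)

Section PolynomialChainRule.

Lemma mpoly_ring_ind n (R : comNzRingType) (P : {mpoly R[n]} -> Prop) :
  (forall c, P c%:MP) -> (forall i, P 'X_i) ->
  (forall p q, P p -> P q -> P (p + q)) ->
  (forall p q, P p -> P q -> P (p * q)) -> forall p, P p.
Proof.
move=> PC PX PD PM p; rewrite [p]mpolyE.
elim/big_ind: _ => [|//|m _]; first by rewrite -mpolyC0.
rewrite -mul_mpolyC; apply: (PM) => //; rewrite mpolyXE_id.
elim/big_ind: _ => [|//|i _]; first by rewrite -mpolyC1.
by elim: (m i) => [|j IH]; rewrite ?expr0 -?mpolyC1 // exprS; exact: PM.
Qed.

Lemma mderivXU n (R : comNzRingType) (i j : 'I_n) :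
  'X_j^`M(i) = (i == j)%:R :> {mpoly R[n]}.
Proof.
rewrite mderivX mnm1E eq_sym; case: eqVneq => [->|_]; last by rewrite scale0r.
by rewrite scale1r -{1}[U_(j)%MM]add0m addmK mpolyX0.
Qed.

Variables (n : nat) (R K : comNzRingType) (phi : {rmorphism R -> K}).
Variable h : 'I_n -> K.

Lemma rmorph_mmap (L : comNzRingType) (psi : {rmorphism K -> L})
    (chi : {rmorphism R -> L}) (p : {mpoly R[n]}) :
  (forall c, psi (phi c) = chi c) ->
  psi (mmap phi h p) = mmap chi (fun i => psi (h i)) p.
Proof.
move=> E; elim/mpoly_ring_ind: p => [c|i|p q IHp IHq|p q IHp IHq].
- by rewrite !mmapC E.
- by rewrite !mmapX !mmap1U.
- by rewrite !rmorphD /= IHp IHq.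
- by rewrite !rmorphM /= IHp IHq.
Qed.

(** Both sides obey the Leibniz rule in [p], so constants and variables suffice. It serves for the
    time derivative and for directional derivatives of polynomials. *)
Lemma mmap_chain_rule (d : {additive K -> K}) (p : {mpoly R[n]}) :
  (forall a b, d (a * b) = d a * b + a * d b) ->
  (forall c, d (phi c) = 0) ->
  d (mmap phi h p) = \sum_i mmap phi h p^`M(i) * d (h i).
Proof.
move=> dM dC; elim/mpoly_ring_ind: p => [c|i|p q IHp IHq|p q IHp IHq].
- by rewrite mmapC dC big1 // => i _; rewrite mderivC rmorph0 mul0r.
- rewrite mmapX mmap1U (bigD1 i) //= big1 => [|j ji].
    by rewrite mderivXU eqxx rmorph1 mul1r addr0.
  by rewrite mderivXU (negPf ji) rmorph0 mul0r.
- rewrite rmorphD /= raddfD /= IHp IHq -big_split; apply: eq_bigr => i _ /=.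
  by rewrite mderivD rmorphD mulrDl.
- rewrite rmorphM /= dM IHp IHq mulr_suml mulr_sumr -big_split /=.
  apply: eq_bigr => i _; rewrite mderivM rmorphD !rmorphM /=.
  by rewrite mulrDl mulrAC !mulrA.
Qed.

End PolynomialChainRule.

(** * The vanishing ideal of the group and its invariant derivations *)

Section AlgebraicGroup.
Variables (k : fieldType) (N : nat) (G : lin_alg_group k N).
Implicit Types (p q : {mpoly k[N * N]}) (X : 'M[k]_N).

Local Notation ev phi x := (mmap phi (fun i => mxvec x 0 i)).
Local Notation I := (vanishing_ideal G).

Lemma vanishing_idealD p q : I p -> I q -> I (p + q).
Proof. by move=> Ip Iq x Gx; rewrite /peval mevalD -!/(peval _ _) Ip ?Iq ?addr0. Qed.

Lemma vanishing_idealM p q : I q -> I (p * q).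
Proof. by move=> Iq x Gx; rewrite /peval mevalM -!/(peval _ _) Iq ?mulr0. Qed.

(** The universal point: evaluating its entries at [x] gives back [x]. *)
Definition generic_matrix : 'M[{mpoly k[N * N]}]_N := vec_mx (\row_i 'X_i).

Lemma mxvec_generic i : mxvec generic_matrix 0 i = 'X_i.
Proof. by rewrite vec_mxK mxE. Qed.

Lemma map_generic (K : comNzRingType) (phi : {rmorphism k -> K}) (x : 'M[K]_N) :
  map_mx (ev phi x) generic_matrix = x.
Proof.
apply: (can_inj mxvecK); rewrite -map_mxvec; apply/rowP => i.
by rewrite mxE mxvec_generic mmapX mmap1U.
Qed.

Lemma peval_map (K : fieldType) (phi : {rmorphism k -> K}) p (x : 'M[K]_N) :
  peval (map_mpoly phi p) x = ev phi x p.
Proof.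
rewrite /peval /meval /map_mpoly.
rewrite (@rmorph_mmap _ _ _ _ _ _ _ phi) => [|c]; last by rewrite /= mmapC.
by congr mmap; apply/funext => i; rewrite /= mmapX mmap1U.
Qed.

(** The polynomial [y |-> p (g y h)] also vanishes on [G], so its differential at 1 kills [X]; the
    chain rule does the rest. *)
Lemma diff_translate p X g h : I p -> lie_algebra G X -> G g -> G h ->
  \sum_j peval p^`M(j) (g *m h) * mxvec (g *m X *m h) 0 j = 0.
Proof.
move=> Ip LX Gg Gh.
pose C := @mpolyC (N * N) k.
pose M := map_mx C g *m generic_matrix *m map_mx C h.
pose q := ev C M p.
have evC y c : ev idfun y (C c) = c by rewrite mmapC.
have evM y : map_mx (ev idfun y) M = g *m y *m h.
  rewrite !map_mxM map_generic -!map_mx_comp.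
  by congr (_ *m _ *m _); apply/matrixP => i j; rewrite !mxE /= evC.
have ev_q y r : ev idfun y (ev C M r) = peval r (g *m y *m h).
  rewrite (@rmorph_mmap _ _ _ _ _ _ _ idfun) => [|c]; last exact: evC.
  by congr mmap; apply/funext => i; rewrite -evM -map_mxvec [RHS]mxE.
have Iq : I q.
  by move=> y Gy; rewrite /peval /meval ev_q; apply: Ip; do 2 apply: lagM => //.
(* [D] differentiates in the constant direction [X]; its value at 1 is [diff1]. *)
pose D r : {mpoly k[N * N]} := \sum_i mxvec X 0 i *: r^`M(i).
have D_zmod : zmod_morphism D.
  move=> r s; rewrite /D -sumrB; apply: eq_bigr => i _.
  by rewrite mderivB scalerBr.
pose Da : {additive _ -> _} := HB.pack D (GRing.isZmodMorphism.Build _ _ D D_zmod).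
have D_sum (F : 'I_N -> _) : D (\sum_j F j) = \sum_j D (F j).
  exact: (raddf_sum Da).
have DM r s : D (r * s) = D r * s + r * D s.
  rewrite /D mulr_suml mulr_sumr -big_split; apply: eq_bigr => i _ /=.
  by rewrite mderivM scalerDr scalerAl scalerAr.
have DC c : D (C c) = 0 by rewrite /D big1 // => i _; rewrite mderivC scaler0.
have Dgen : map_mx D generic_matrix = map_mx C X.
  apply: (can_inj mxvecK); rewrite -!map_mxvec; apply/rowP => i.
  rewrite mxE mxvec_generic mxE /D (bigD1 i) //= big1 => [|j ji].
    by rewrite mderivXU eqxx addr0 -mul_mpolyC mulr1.
  by rewrite mderivXU (negPf ji) scaler0.
have DmulC (Z : 'M_N) : map_mx D (map_mx C g *m Z) = map_mx C g *m map_mx D Z.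
  apply/matrixP => i j; rewrite mxE mxE D_sum mxE; apply: eq_bigr => l _.
  by rewrite DM !mxE DC mul0r add0r.
have DCmul (Z : 'M_N) : map_mx D (Z *m map_mx C h) = map_mx D Z *m map_mx C h.
  apply/matrixP => i j; rewrite mxE mxE D_sum mxE; apply: eq_bigr => l _.
  by rewrite DM !mxE DC mulr0 addr0.
have DMmx : map_mx D M = map_mx C (g *m X *m h).
  by rewrite DCmul DmulC Dgen !map_mxM.
have := LX q Iq; rewrite /diff1.
have -> : \sum_i peval q^`M(i) 1%:M * mxvec X 0 i = ev idfun 1%:M (D q).
  rewrite raddf_sum; apply: eq_bigr => i _ /=.
  by rewrite mmapZ mulrC.
rewrite /q -[D _]/(Da _) mmap_chain_rule // raddf_sum /= => E; rewrite -[RHS]E.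
apply: eq_bigr => j _; rewrite rmorphM /= ev_q mulmx1; congr (_ * _).
transitivity (ev idfun 1%:M (map_mx D (mxvec M) 0 j)); last by rewrite mxE.
by rewrite map_mxvec DMmx -map_mxvec mxE evC.
Qed.

(** The derivative at [x] in the direction [x X], that is, along a left invariant vector field;
    [left_derivation] uses [X x]. *)
Definition right_derivation X p :=
  \sum_j p^`M(j) * mxvec (generic_matrix *m map_mx (@mpolyC _ k) X) 0 j.

Definition left_derivation X p :=
  \sum_j p^`M(j) * mxvec (map_mx (@mpolyC _ k) X *m generic_matrix) 0 j.

Section Evaluation.
Variables (K : comNzRingType) (phi : {rmorphism k -> K}) (x : 'M[K]_N).

Let ev_const X : map_mx (ev phi x) (map_mx (@mpolyC _ k) X) = map_mx phi X.
Proof. by rewrite -map_mx_comp; apply/matrixP => i j; rewrite !mxE /= mmapC. Qed.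

Let ev_mxvec (M : 'M[{mpoly k[N * N]}]_N) j :
  ev phi x (mxvec M 0 j) = mxvec (map_mx (ev phi x) M) 0 j.
Proof. by rewrite -map_mxvec [RHS]mxE. Qed.

Lemma ev_right_derivation X p : ev phi x (right_derivation X p) =
  \sum_j ev phi x p^`M(j) * mxvec (x *m map_mx phi X) 0 j.
Proof.
rewrite raddf_sum; apply: eq_bigr => j _; rewrite /= rmorphM /=; congr (_ * _).
by rewrite ev_mxvec map_mxM map_generic ev_const.
Qed.

Lemma ev_left_derivation X p : ev phi x (left_derivation X p) =
  \sum_j ev phi x p^`M(j) * mxvec (map_mx phi X *m x) 0 j.
Proof.
rewrite raddf_sum; apply: eq_bigr => j _; rewrite /= rmorphM /=; congr (_ * _).
by rewrite ev_mxvec map_mxM map_generic ev_const.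
Qed.

End Evaluation.

Lemma vanishing_right_derivation X p :
  lie_algebra G X -> I p -> I (right_derivation X p).
Proof.
move=> LX Ip g Gg; have := diff_translate Ip LX Gg (lag1 G).
rewrite !mulmx1 /peval /meval ev_right_derivation => E; rewrite -[RHS]E.
by apply: eq_bigr => j _; rewrite map_mx_id.
Qed.

Lemma vanishing_left_derivation X p :
  lie_algebra G X -> I p -> I (left_derivation X p).
Proof.
move=> LX Ip g Gg; have := diff_translate Ip LX (lag1 G) Gg.
rewrite !mul1mx /peval /meval ev_left_derivation => E; rewrite -[RHS]E.
by apply: eq_bigr => j _; rewrite map_mx_id.
Qed.

Local Notation C := (@puiseuxC k).
Local Notation toF := (map_mx C).

(** Constants have order 0, so sums and products preserve congruences modulo [t^m] for [m >= 0]. *)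
Lemma ev_congr1 (m : int) (x : 'M[puiseux k]_N) p :
  0 <= m -> mordge m (x - 1%:M) -> ordge m (ev C x p - C (peval p 1%:M)).
Proof.
move=> m0 Hx; elim/mpoly_ring_ind: p => [c|i|p q IHp IHq|p q IHp IHq].
- by rewrite mmapC /peval mevalC subrr; exact: ordge0.
- rewrite mmapX mmap1U /peval mevalXU; case/mxvec_indexP: i => i j.
  rewrite !mxvecE; have := Hx i j; rewrite !mxE.
  by congr (ordge _ (_ - _)); rewrite rmorph_nat.
- rewrite rmorphD /= /peval mevalD rmorphD /= opprD addrACA.
  exact: ordgeD.
rewrite rmorphM /= /peval mevalM rmorphM /= -!/(peval _ _).
set a := mmap _ _ p in IHp *; set b := mmap _ _ q in IHq *.
set c := C (peval p _) in IHp *; set d := C (peval q _) in IHq *.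
have -> : a * b - c * d = (a - c) * (b - d + d) + c * (b - d) by ring.
apply: ordgeD; last by rewrite -[m]add0r; apply: ordgeM => //; exact: ordgeC.
rewrite -[m]addr0; apply: ordgeM => //; apply: ordgeD; last exact: ordgeC.
exact: ordgeW IHq.
Qed.

Hypothesis char0 : [pchar k] =i pred0.

Let mxvec_sum m (F : 'I_m -> 'M[puiseux k]_N) j :
  mxvec (\sum_l F l) 0 j = \sum_l mxvec (F l) 0 j.
Proof. by rewrite linear_sum summxE. Qed.

Let mxvecZ c (Z : 'M[puiseux k]_N) j : mxvec (c *: Z) 0 j = c * mxvec Z 0 j.
Proof. by rewrite linearZ mxE. Qed.

Let mxvecB (Z W : 'M[puiseux k]_N) j :
  mxvec (Z - W) 0 j = mxvec Z 0 j - mxvec W 0 j.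
Proof. by rewrite linearB mxE [(- mxvec _) _ _]mxE. Qed.

(** Along a solution [x], the term [A x] acts by left derivations and [x (A + E)] by right ones. For
    [p] in the ideal and [X], [Y] in the Lie algebra, the results stay in the ideal. *)
Lemma ev_time_derivative (mA mE : nat) (a : 'I_mA -> puiseux k)
    (X : 'I_mA -> 'M[k]_N)
    (e : 'I_mE -> puiseux k) (Y : 'I_mE -> 'M[k]_N) (x : 'M[puiseux k]_N) p :
  let A := \sum_l a l *: toF (X l) in
  let E := \sum_l e l *: toF (Y l) in
  map_mx (@pderiv k) x = A *m x - x *m (A + E) ->
  pderiv (ev C x p) =
    \sum_l a l * ev C x (left_derivation (X l) p - right_derivation (X l) p)
    - \sum_l e l * ev C x (right_derivation (Y l) p).
Proof.
move=> A E dx; rewrite (@mmap_chain_rule _ _ _ _ _ (@pderiv k)); first last.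
- exact: pderivC.
- exact: pderivM.
have -> : \sum_l a l * ev C x (left_derivation (X l) p - right_derivation (X l) p)
    = \sum_j ev C x p^`M(j) * mxvec (A *m x - x *m A) 0 j.
  transitivity (\sum_l \sum_j a l * (ev C x p^`M(j) * mxvec (toF (X l) *m x) 0 j
      - ev C x p^`M(j) * mxvec (x *m toF (X l)) 0 j)).
    apply: eq_bigr => l _; rewrite -mulr_sumr sumrB; congr (_ * _).
    rewrite mmapB; congr (_ - _); first exact: ev_left_derivation.
    exact: ev_right_derivation.
  rewrite exchange_big; apply: eq_bigr => j _ /=.
  rewrite /A mulmx_suml mulmx_sumr -sumrB mxvec_sum mulr_sumr.
  apply: eq_bigr => l _; rewrite -scalemxAl -scalemxAr -scalerBr mxvecZ mxvecB.
  by ring.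
have -> : \sum_l e l * ev C x (right_derivation (Y l) p)
    = \sum_j ev C x p^`M(j) * mxvec (x *m E) 0 j.
  under eq_bigr do rewrite ev_right_derivation mulr_sumr.
  rewrite exchange_big; apply: eq_bigr => j _ /=.
  rewrite /E mulmx_sumr mxvec_sum mulr_sumr.
  by apply: eq_bigr => l _; rewrite -scalemxAr mxvecZ; ring.
rewrite -sumrB; apply: eq_bigr => j _; rewrite -mulrBr; congr (_ * _).
transitivity (mxvec (map_mx (@pderiv k) x) 0 j); first by rewrite -map_mxvec mxE.
by rewrite -mxvecB dx mulmxDr opprD addrA.
Qed.

End AlgebraicGroup.

(** * Solving the gauge equation *)

Section CommutatorConnection.
Variables (k : fieldType) (N : nat) (A : 'M[puiseux k]_N) (K : nat).
Hypothesis char0 : [pchar k] =i pred0.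
Hypothesis HA : mordge (- K%:Z) A.

(** The connection [y' - [A, y]] induced on endomorphisms. *)
Let nabla (y : 'M[puiseux k]_N) := map_mx (@pderiv k) y - A *m y + y *m A.

Let nabla_zmod : zmod_morphism nabla.
Proof.
move=> X Y; rewrite /nabla raddfB /= mulmxBr mulmxBl.
by apply/matrixP => i j; rewrite !mxE; ring.
Qed.

Let nablaZ c X : nabla (c *: X) = pderiv c *: X + c *: nabla X.
Proof.
rewrite /nabla -scalemxAl -scalemxAr !scalerDr scalerN !addrA; congr (_ - _ + _).
by apply/matrixP => i j; rewrite !mxE pderivM.
Qed.

Let nabla_ord m X : mordge m X -> mordge (m - K.+1%:Z) (nabla X).
Proof.
move=> HX; apply: mordgeD; last by apply: mordgeW (mordgeM HX HA); lia.
apply: mordgeB; first by apply: mordgeW (mordge_deriv HX); lia.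
by apply: mordgeW (mordgeM HA HX); lia.
Qed.

Lemma gauge_equation_solvable : exists c s0 : nat,
  forall (n : nat) (E : 'M[puiseux k]_N), (s0 <= n)%N -> (c < n)%N ->
  mordge n E ->
  exists2 x, mordge (n%:Z - c%:Z) (x - 1%:M) &
    map_mx (@pderiv k) x = A *m x - x *m (A + E).
Proof.
have [c [s0 Hsurj]] := approx_surjective char0 nabla_zmod nablaZ nabla_ord.
exists c, s0 => n E s0n cn HE.
pose T y := nabla y + y *m E.
have T_zmod : zmod_morphism T.
  move=> X Y; rewrite /T nabla_zmod mulmxBl.
  by apply/matrixP => i j; rewrite !mxE; ring.
have [||| y Hy Ty] := @successive_approximation k N N T K.+1%:Z c%:Z s0%:Z
    T_zmod _ _ n%:Z (- E) _ (mordgeN HE).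
- move=> m X HX; apply: mordgeD; first exact: nabla_ord.
  by apply: mordgeW (mordgeM HX HE); lia.
- move=> M Y hM HY; have [X HX1 HX2] := Hsurj M Y hM HY; exists X => //.
  (* As [n > c], the term [X E] has order at least [M - c + n >= M + 1] and does not disturb the
     approximation. *)
  rewrite /T addrAC; apply: mordgeD => //.
  by apply: mordgeW (mordgeM HX1 HE); lia.
- by lia.
exists (1%:M + y); first by rewrite addrAC subrr add0r.
have -> : map_mx (@pderiv k) (1%:M + y) = map_mx (@pderiv k) y.
  rewrite raddfD /= -[RHS]add0r; congr (_ + _); apply/matrixP => i j.
  by rewrite !mxE; case: (_ == _); [exact: (@pderivC k 1) | exact: raddf0].
have -> : map_mx (@pderiv k) y = T y + A *m y - y *m A - y *m E.
  by rewrite /T /nabla; apply/matrixP => i j; rewrite !mxE; ring.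
rewrite Ty mulmxDr mulmx1 mulmxDl mul1mx mulmxDr.
by apply/matrixP => i j; rewrite !mxE; ring.
Qed.

End CommutatorConnection.

(** The determinant is a polynomial with value 1 at the identity, so [det x] has constant term 1. *)
Lemma unitmx_congr1 (k : fieldType) (N : nat) (m : int) (x : 'M[puiseux k]_N) :
  0 < m -> mordge m (x - 1%:M) -> x \in unitmx.
Proof.
move=> m0 Hx; rewrite unitmxE unitfE; apply/eqP => det0.
have := ev_congr1 (p := \det (generic_matrix k N)) (ltW m0) Hx.
rewrite -peval_map peval_map -det_map_mx map_generic det0.
have -> : peval (\det (generic_matrix k N)) 1%:M = 1.
  by rewrite /peval /meval -det_map_mx map_generic det1.
move/ordge_lt => /(_ 0 m0) /eqP.
by rewrite sub0r /= ?eqxx oppr_eq0 oner_eq0.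
Qed.

Theorem proposition4p23 (k : closedFieldType) (N : nat)
  (G : lin_alg_group k N) (A : 'M[puiseux k]_N) :
  [pchar k]%R =i pred0 ->
  lag_connected G -> lag_reductive G ->
  connection G A ->
  exists2 n : nat, (0 < n)%N &
    forall C : 'M[puiseux k]_N, connection G C ->
      congr_mod_tpow G n C A -> gauge_equiv G C A.
Proof.
move=> char0 _ _ [mA [a [X [La LX AE]]]].
pose toF := @puiseuxC k.
pose ev (x : 'M[puiseux k]_N) := mmap toF (fun i => mxvec x 0 i).
have [K Ha] : exists K : nat, forall l, ordge (- K%:Z) (a l).
  have [m Hm] : exists m, mordge m (\row_l a l).
    by apply: mordge_laurent => i j; rewrite mxE.
  exists `|m|%N => l; have := Hm 0 l; rewrite mxE; apply: ordgeW; lia.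
have HA : mordge (- K%:Z) A.
  rewrite AE; apply: mordge_sum => l _; rewrite -[- K%:Z]addr0.
  by apply: mordgeZ => //; exact: mordge_map.
have [c1 [s1 Hsolve]] := gauge_equation_solvable char0 HA.
have [s Is gens] :=
  hilbert_basis (@vanishing_idealD k N G) (@vanishing_idealM k N G).
pose r := size s.
have Isi (i : 'I_r) : vanishing_ideal G s`_i by apply: Is; exact: mem_nth.
have /choice [h Hh] : forall il : 'I_r * 'I_mA,
    exists h : nat -> {mpoly k[N * N]},
    left_derivation (X il.2) s`_il.1 - right_derivation (X il.2) s`_il.1 =
    \sum_(j < r) h j * s`_j.
  move=> [i l]; apply: gens; rewrite -mulN1r; apply: vanishing_idealD.
    exact: vanishing_left_derivation.
  by apply: vanishing_idealM; exact: vanishing_right_derivation.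
(* The system at [x = 1]. It is fixed before [C], so the constants [c2] and [s2] depend on [A]
   only. *)
pose B : 'M[puiseux k]_r :=
  \matrix_(j, i) \sum_l a l * toF (peval (h (i, l) j) 1%:M).
have HB : mordge (- K%:Z) B.
  move=> j i; rewrite mxE; apply: ordge_sum => l _; rewrite -[- K%:Z]addr0.
  by apply: ordgeM => //; exact: ordgeC.
have [c2 [s2 Hinj]] := approx_injective char0 HB.
(* Beyond solving the gauge equation ([c1], [s1]), this makes [R] of order [c2] despite the poles of
   order [K], and starts [v] at order [s2]. *)
pose n := (c1 + s1 + c2 + s2 + K + 2)%N.
exists n; first by rewrite /n; lia.
move=> C _ [mE [e [Y [He LY CE]]]].
pose E := C - A.
have HE : mordge n E.
  rewrite /E CE; apply: mordge_sum => l _; rewrite -[n%:Z]addr0.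
  by apply: mordgeZ; [exact: He | exact: mordge_map].
have [||x Hx dx] := Hsolve n E _ _ HE; try by rewrite /n; lia.
have CAE : A + E = C by rewrite /E addrC subrK.
have xU : x \in unitmx by apply: unitmx_congr1 Hx; rewrite /n; lia.
have ev_ord p : ordge (n%:Z - c1%:Z) (ev x p - toF (peval p 1%:M)).
  by apply: ev_congr1 Hx; rewrite /n; lia.
have /choice [g Hg] : forall il : 'I_r * 'I_mE,
    exists g : nat -> {mpoly k[N * N]},
    right_derivation (Y il.2) s`_il.1 = \sum_(j < r) g j * s`_j.
  by move=> [i l]; apply: gens; exact: vanishing_right_derivation.
(* [v' = v B + v R] with [R] of order larger than the loss of order [c2] of the
   connection [v' - v B], so that the order of [v] can be raised indefinitely. *)
pose v := \row_(i < r) ev x s`_i.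
pose R := \matrix_(j < r, i < r)
  (\sum_l a l * (ev x (h (i, l) j) - toF (peval (h (i, l) j) 1%:M))
   - \sum_l e l * ev x (g (i, l) j)).
have HR : mordge c2%:Z R.
  move=> j i; rewrite mxE; apply: ordgeB; apply: ordge_sum => l _.
    by apply: ordgeW (ordgeM (Ha l) (ev_ord _)); rewrite /n; lia.
  apply: (@ordgeW _ (n%:Z + 0)); first by rewrite /n; lia.
  apply: ordgeM; first exact: He.
  rewrite -[ev x _](subrK (toF (peval (g (i, l) j) 1%:M))).
  apply: ordgeD; last exact: ordgeC.
  by apply: ordgeW (ev_ord _); rewrite /n; lia.
have dv : map_mx (@pderiv k) v - v *m B = v *m R.
  apply/eqP; rewrite subr_eq -mulmxDr; apply/eqP/rowP => i.
  rewrite [LHS]mxE [v 0 i]mxE.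
  have dx' := dx; rewrite AE /E CE in dx'.
  rewrite (ev_time_derivative char0 _ dx') [RHS]mxE.
  have evh l : ev x (left_derivation (X l) s`_i - right_derivation (X l) s`_i)
      = \sum_(j < r) ev x (h (i, l) j) * v 0 j.
    rewrite (Hh (i, l)) /ev raddf_sum; apply: eq_bigr => j _ /=.
    by rewrite rmorphM [v 0 j]mxE.
  have evg l : ev x (right_derivation (Y l) s`_i) =
      \sum_(j < r) ev x (g (i, l) j) * v 0 j.
    rewrite (Hg (i, l)) /ev raddf_sum; apply: eq_bigr => j _ /=.
    by rewrite rmorphM [v 0 j]mxE.
  transitivity (\sum_(j < r) \sum_l a l * (ev x (h (i, l) j) * v 0 j)
      - \sum_(j < r) \sum_l e l * (ev x (g (i, l) j) * v 0 j)).
    congr (_ - _); rewrite [RHS]exchange_big; apply: eq_bigr => l _ /=.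
      by rewrite -mulr_sumr -evh.
    by rewrite -mulr_sumr -evg.
  rewrite -sumrB; apply: eq_bigr => j _.
  rewrite [(R + B) j i]mxE [R j i]mxE [B j i]mxE.
  rewrite addrAC -big_split mulrBr; congr (_ - _); rewrite mulr_sumr.
    by apply: eq_bigr => l _ /=; ring.
  by apply: eq_bigr => l _ /=; ring.
have Hv (i : nat) : mordge (s2%:Z + i%:Z) v.
  elim: i => [|i IH].
    (* The generators vanish at 1, so [v] inherits the order of [x - 1]. *)
    move=> z j; rewrite mxE; have := ev_ord s`_j.
    rewrite (Isi j _ (lag1 G)) rmorph0 subr0; apply: ordgeW; rewrite /n; lia.
  have -> : s2%:Z + i.+1%:Z = s2%:Z + i%:Z + 1 by lia.
  apply: Hinj => //; first lia.
  by rewrite dv; exact: mordgeM IH HR.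
have v0 : v = 0 by apply: mordge_eq0 => i; apply: mordgeW (Hv i); lia.
exists x.
  split=> // p Ip; rewrite peval_map; have [q ->] := gens p Ip.
  rewrite raddf_sum big1 // => j _ /=; rewrite rmorphM /=.
  have /rowP /(_ j) := v0; rewrite !mxE /ev => ->; exact: mulr0.
(* Since [x C + x' = A x], the matrix [x] carries [C] to [A]. *)
rewrite /gauge_act dx CAE -mulmxDl addrC subrK.
by rewrite -mulmxA mulmxV // mulmx1.
Qed.
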